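(* Let $f:\mathbb{R}^{d_1}\times\mathbb{R}^{d_2}\to\mathbb{R}$ be continuously differentiable, have Lipschitz gradient with constant $l>0$, satisfy the existence-of-saddle-point assumption, and satisfy the two-sided PL condition with constants $\mu_1,\mu_2>0$, where $\mu_1,\mu_2\le l$. Let $G_x,G_y$ be unbiased stochastic gradients of $f$ with variance bounded by $\sigma^2$. Let $(x_t,y_t)_{t\ge0}$ be generated by Stoc-AGDA with stepsizes $$\tau_1^t=\frac{\beta}{\gamma+t},\qquad \tau_2^t=\frac{18l^2\beta}{\mu_2^2(\gamma+t)}$$ for some $\beta>2/\mu_1$ and $\gamma>0$ such that $\tau_1^0\le\min\{1/L,\ \mu_2^2/(18l^3)\}$. Put $P_t:=a_t+\frac1{10}b_t$. Then for all $t\ge0$, $$P_t\le\frac{\nu}{\gamma+t},\qquad \nu:=\max\Big\{\gamma P_0,\ \frac{\big[(L+l)\beta^2+18^2l^5\beta^2/\mu_2^4+10L\beta^2\big]\sigma^2}{10\mu_1\beta-20}\Big\}.$$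
   Context: Norms are Euclidean. Problem: $\min_{x\in\mathbb{R}^{d_1}}\max_{y\in\mathbb{R}^{d_2}} f(x,y)$. Lipschitz gradient with constant $l$: for all $x_1,x_2\in\mathbb{R}^{d_1}$, $y_1,y_2\in\mathbb{R}^{d_2}$, $\|\nabla_x f(x_1,y_1)-\nabla_x f(x_2,y_2)\|\le l[\|x_1-x_2\|+\|y_1-y_2\|]$ and $\|\nabla_y f(x_1,y_1)-\nabla_y f(x_2,y_2)\|\le l[\|x_1-x_2\|+\|y_1-y_2\|]$. Existence of saddle point: there is $(x^*,y^* )$ with $f(x^*,y)\le f(x^*,y^* )\le f(x,y^* )$ for all $(x,y)$; moreover for every $y$, $\min_x f(x,y)$ has a nonempty solution set and finite optimal value, and for every $x$, $\max_y f(x,y)$ has a nonempty solution set and finite optimal value. Two-sided PL condition with constants $\mu_1,\mu_2>0$: for all $(x,y)$, $\|\nabla_x f(x,y)\|^2\ge 2\mu_1[f(x,y)-\min_{x'}f(x',y)]$ and $\|\nabla_y f(x,y)\|^2\ge 2\mu_2[\max_{y'}f(x,y')-f(x,y)]$. Stochastic gradients: $G_x(x,y,\xi),G_y(x,y,\xi)$, with $\xi$ a random vector of law $P$, satisfy for every $(x,y)$: $\mathbb{E}_\xi[G_x(x,y,\xi)]=\nabla_x f(x,y)$, $\mathbb{E}_\xi[G_y(x,y,\xi)]=\nabla_y f(x,y)$, $\mathbb{E}_\xi\|G_x(x,y,\xi)-\nabla_xf(x,y)\|^2\le\sigma^2$, $\mathbb{E}_\xi\|G_y(x,y,\xi)-\nabla_yf(x,y)\|^2\le\sigma^2$.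 Stoc-AGDA: from a given $(x_0,y_0)$, for $t=0,1,2,\dots$ draw two i.i.d. samples $\xi_{t1},\xi_{t2}\sim P$ (independent of the past) and set $x_{t+1}=x_t-\tau_1^tG_x(x_t,y_t,\xi_{t1})$, then $y_{t+1}=y_t+\tau_2^tG_y(x_{t+1},y_t,\xi_{t2})$. Notation: $g(x):=\max_y f(x,y)$, $g^*:=\min_x g(x)$, $a_t:=\mathbb{E}[g(x_t)-g^*]$, $b_t:=\mathbb{E}[g(x_t)-f(x_t,y_t)]$, $L:=l+l^2/\mu_2$. *)

(* Defs.v *)
From HB Require Import structures.
From mathcomp Require Import all_boot all_order all_algebra.
From mathcomp Require Import all_classical all_reals all_analysis.
Set Implicit Arguments.
Unset Strict Implicit.
Unset Printing Implicit Defensive.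
Import Order.TTheory GRing.Theory Num.Theory.
Import numFieldNormedType.Exports.
Local Open Scope classical_set_scope.
Local Open Scope ring_scope.

(* Row vectors carry the sigma-algebra generated by the coordinates, which over
   a realType is the Borel sigma-algebra of R^n. *)
Definition measure_row_display : measure_display -> measure_display.
Proof. exact. Qed.

Section measurable_row.
Context {d : measure_display} {T : measurableType d}.
Variable n : nat.

Let coords : 'I_n -> 'rV[T]_n -> T := fun i v => v ord0 i.

Let row_set0 : g_sigma_preimage coords set0.
Proof. exact: sigma_algebra0. Qed.

Let row_setC A : g_sigma_preimage coords A -> g_sigma_preimage coords (~` A).
Proof. exact: sigma_algebraC. Qed.

Let row_bigcup (F : (set 'rV[T]_n)^nat) :
  (forall i, g_sigma_preimage coords (F i)) ->
  g_sigma_preimage coords (\bigcup_i (F i)).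
Proof. exact: sigma_algebra_bigcup. Qed.

HB.instance Definition _ := @isMeasurable.Build (measure_row_display d)
  'rV[T]_n (g_sigma_preimage coords) row_set0 row_setC row_bigcup.

End measurable_row.

Section euclidean_gradient.
Context {R : realType}.

(* The library norm `|v| on row vectors is the sup norm. *)
Definition enorm n (v : 'rV[R]_n) : R := Num.sqrt (\sum_i v ord0 i ^+ 2).

Definition gradient n (h : 'rV[R]_n -> R) (x : 'rV[R]_n) : 'rV[R]_n :=
  \row_i 'D_(delta_mx ord0 i) h x.

End euclidean_gradient.

Section minimax.
Context {R : realType} {d1 d2 : nat}.
Implicit Types (f : 'rV[R]_d1 -> 'rV[R]_d2 -> R) (l mu : R).

Definition grad_x f x y : 'rV[R]_d1 := gradient (fun x' => f x' y) x.
Definition grad_y f x y : 'rV[R]_d2 := gradient (fun y' => f x y') y.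

(* The partial derivatives of f are the entries of grad_x f and grad_y f, so
   the last two clauses say that the differential of f is continuous. *)
Definition continuously_differentiable f :=
  [/\ forall z : 'rV[R]_d1 * 'rV[R]_d2,
        differentiable (fun u : 'rV[R]_d1 * 'rV[R]_d2 => f u.1 u.2) z,
      continuous (fun u : 'rV[R]_d1 * 'rV[R]_d2 => grad_x f u.1 u.2) &
      continuous (fun u : 'rV[R]_d1 * 'rV[R]_d2 => grad_y f u.1 u.2)].

Definition lipschitz_gradient f l := forall x1 x2 y1 y2,
  enorm (grad_x f x1 y1 - grad_x f x2 y2)
    <= l * (enorm (x1 - x2) + enorm (y1 - y2)) /\
  enorm (grad_y f x1 y1 - grad_y f x2 y2)
    <= l * (enorm (x1 - x2) + enorm (y1 - y2)).

(* Optimal values are real numbers because f is real-valued and, under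
   saddle_point_assumption, attained: the sup and inf below are a max and a
   min. *)
Definition saddle_point_assumption f :=
  [/\ exists xs ys, forall x y, f xs y <= f xs ys /\ f xs ys <= f x ys,
      forall y, exists xs, forall x, f xs y <= f x y &
      forall x, exists ys, forall y, f x y <= f x ys].

Definition max_y f (x : 'rV[R]_d1) : R := sup (range (f x)).
Definition min_x f (y : 'rV[R]_d2) : R := inf (range (f ^~ y)).
Definition minmax f : R := inf (range (max_y f)).

Definition two_sided_PL f mu1 mu2 := forall x y,
  2 * mu1 * (f x y - min_x f y) <= enorm (grad_x f x y) ^+ 2 /\
  2 * mu2 * (max_y f x - f x y) <= enorm (grad_y f x y) ^+ 2.

End minimax.

Section stochastic.
Context {R : realType}.

(* A measurable function with a finite 'E_Q is integrable, so the mean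
   condition contains integrability. *)
Definition unbiased_bounded_variance dS (S : measurableType dS)
    (Q : probability S R) n (G : S -> 'rV[R]_n) (m : 'rV[R]_n) (sigma : R) :=
  (forall i, 'E_Q[fun s => G s ord0 i] = (m ord0 i)%:E)%E /\
  ('E_Q[fun s => (enorm (G s - m) ^+ 2)%R] <= (sigma ^+ 2)%:E)%E.

(* Joint measurability makes the iterates random vectors. *)
Definition stochastic_gradients d1 d2 (f : 'rV[R]_d1 -> 'rV[R]_d2 -> R)
    dS (S : measurableType dS) (Q : probability S R)
    (Gx : 'rV[R]_d1 -> 'rV[R]_d2 -> S -> 'rV[R]_d1)
    (Gy : 'rV[R]_d1 -> 'rV[R]_d2 -> S -> 'rV[R]_d2) (sigma : R) :=
  [/\ measurable_fun setT
        (fun z : 'rV[R]_d1 * 'rV[R]_d2 * S => Gx z.1.1 z.1.2 z.2),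
      measurable_fun setT
        (fun z : 'rV[R]_d1 * 'rV[R]_d2 * S => Gy z.1.1 z.1.2 z.2),
      forall x y, unbiased_bounded_variance Q (Gx x y) (grad_x f x y) sigma &
      forall x y, unbiased_bounded_variance Q (Gy x y) (grad_y f x y) sigma].

Definition mutually_independent dO (Omega : measurableType dO)
    (P : probability Omega R) dS (S : measurableType dS) (I : eqType)
    (X : I -> {RV P >-> S}) :=
  forall (s : seq I) (A : I -> set S), uniq s ->
    (forall i, i \in s -> measurable (A i)) ->
    (P (\bigcap_(i in [set` s]) (X i @^-1` A i)) =
     \prod_(i <- s) P (X i @^-1` A i))%E.

Definition iid_samples dO (Omega : measurableType dO)
    (P : probability Omega R) dS (S : measurableType dS) (Q : probability S R)
    (xi1 xi2 : nat -> {RV P >-> S}) :=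
  [/\ forall t A, measurable A -> distribution P (xi1 t) A = Q A,
      forall t A, measurable A -> distribution P (xi2 t) A = Q A &
      mutually_independent (fun k : nat + nat =>
        match k with inl t => xi1 t | inr t => xi2 t end)].

Fixpoint stoc_agda d1 d2 (S : Type)
    (Gx : 'rV[R]_d1 -> 'rV[R]_d2 -> S -> 'rV[R]_d1)
    (Gy : 'rV[R]_d1 -> 'rV[R]_d2 -> S -> 'rV[R]_d2)
    (tau1 tau2 : nat -> R) (x0 : 'rV[R]_d1) (y0 : 'rV[R]_d2)
    (s1 s2 : nat -> S) (t : nat) : 'rV[R]_d1 * 'rV[R]_d2 :=
  if t is t'.+1 then
    let: (x, y) := stoc_agda Gx Gy tau1 tau2 x0 y0 s1 s2 t' in
    let x' := x - tau1 t' *: Gx x y (s1 t') in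
    (x', y + tau2 t' *: Gy x' y (s2 t'))
  else (x0, y0).

(* a_t + b_t / 10 for Z = (x_t, y_t); both expectations are taken in \bar R, of
   functions that are nonnegative under saddle_point_assumption. *)
Definition potential dO (Omega : measurableType dO) (P : probability Omega R)
    d1 d2 (f : 'rV[R]_d1 -> 'rV[R]_d2 -> R)
    (Z : Omega -> 'rV[R]_d1 * 'rV[R]_d2) : \bar R :=
  ('E_P[fun w => (max_y f (Z w).1 - minmax f)%R] +
   (10^-1)%:E * 'E_P[fun w => (max_y f (Z w).1 - f (Z w).1 (Z w).2)%R])%E.

End stochastic.

(* Main.v *)
(* The function g = max_y f is smooth with constant L = l + l^2 / mu2: the PL
   inequality in y bounds the distance of y to the maximisers of f x by
   sqrt (2 (g x - f x y) / mu2), hence the maximisers move Lipschitz-continuously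
   with x, they all give the same value of grad_x f (the gradient of g at x), and
   mu2 |grad_x f x y - grad g x|^2 <= 2 l^2 (g x - f x y).  Moreover g inherits
   the PL inequality of f (., y) with constant mu1.

   Given the current iterate, the descent step decreases g in expectation by
   tau1 / 2 |grad g|^2 up to an error controlled by g - f, and the ascent step
   contracts g - f by 1 - mu2 tau2.  For V = (g - min g) + (g - f) / 10 and the given
   ratio tau2 / tau1 the errors are absorbed, leaving
   E V(z_(t+1)) <= (1 - mu1 tau1 / 2) E V(z_t) + C tau1^2 sigma^2, from which the
   rate follows by induction.  Each new sample is independent of the current
   iterate, so the conditional expectations are integrals against Q, by Tonelli. *)

Require Import Defs.
From HB Require Import structures.
From mathcomp Require Import all_boot all_order all_algebra.
From mathcomp Require Import all_classical all_reals all_analysis.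
From mathcomp Require Import measurable_realfun ring lra.
Set Implicit Arguments.
Unset Strict Implicit.
Unset Printing Implicit Defensive.
Import Order.TTheory GRing.Theory Num.Theory.
Import numFieldNormedType.Exports.
Local Open Scope classical_set_scope.
Local Open Scope ring_scope.

(** * Euclidean geometry *)

Section euclidean.
Context {R : realType} {n : nat}.
Implicit Types (u v w : 'rV[R]_n) (a : R).

Definition dot u v : R := \sum_i u ord0 i * v ord0 i.

Lemma dotC u v : dot u v = dot v u.
Proof. by apply: eq_bigr => i _; rewrite mulrC. Qed.

Lemma dotDl u v w : dot (u + v) w = dot u w + dot v w.
Proof. by rewrite -big_split/=; apply: eq_bigr => i _; rewrite mxE mulrDl. Qed.

Lemma dotZl a u v : dot (a *: u) v = a * dot u v.
Proof. by rewrite mulr_sumr; apply: eq_bigr => i _; rewrite mxE mulrA. Qed.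

Lemma dotNl u v : dot (- u) v = - dot u v.
Proof. by rewrite -scaleN1r dotZl mulN1r. Qed.

Lemma dotBl u v w : dot (u - v) w = dot u w - dot v w.
Proof. by rewrite dotDl dotNl. Qed.

Lemma dotDr u v w : dot w (u + v) = dot w u + dot w v.
Proof. by rewrite dotC dotDl !(dotC w). Qed.

Lemma dotZr a u v : dot u (a *: v) = a * dot u v.
Proof. by rewrite dotC dotZl dotC. Qed.

Lemma dotNr u v : dot u (- v) = - dot u v.
Proof. by rewrite dotC dotNl dotC. Qed.

Lemma dotvv_ge0 u : 0 <= dot u u.
Proof. by apply: sumr_ge0 => i _; rewrite -expr2 sqr_ge0. Qed.

Lemma enorm_sqr u : enorm u ^+ 2 = dot u u.
Proof.
rewrite sqr_sqrtr; last by apply: sumr_ge0 => i _; rewrite sqr_ge0.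
by apply: eq_bigr => i _; rewrite expr2.
Qed.

Lemma enorm_ge0 u : 0 <= enorm u.
Proof. exact: sqrtr_ge0. Qed.

Lemma enorm0 : enorm (0 : 'rV[R]_n) = 0.
Proof.
apply/eqP; rewrite -sqrf_eq0 enorm_sqr /dot big1 // => i _.
by rewrite mxE mul0r.
Qed.

Lemma enorm_eq0 u : (enorm u == 0) = (u == 0).
Proof.
apply/eqP/eqP => [u0|->]; last exact: enorm0.
have : dot u u == 0 by rewrite -enorm_sqr u0 expr0n.
rewrite /dot psumr_eq0; last by move=> i _; rewrite -expr2 sqr_ge0.
move=> /allP h; apply/rowP => i; rewrite mxE.
by have /implyP/(_ isT) := h i (mem_index_enum _); rewrite mulf_eq0 orbb => /eqP.
Qed.

Lemma enormZ a u : enorm (a *: u) = `|a| * enorm u.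
Proof.
apply/eqP; rewrite -(@eqrXn2 _ 2)// ?enorm_ge0 ?mulr_ge0 ?enorm_ge0//.
by rewrite exprMn real_normK ?num_real// !enorm_sqr dotZl dotZr mulrA expr2.
Qed.

Lemma enormN u : enorm (- u) = enorm u.
Proof. by rewrite -scaleN1r enormZ normrN1 mul1r. Qed.

Lemma enormB u v : enorm (u - v) = enorm (v - u).
Proof. by rewrite -enormN opprB. Qed.

Lemma dot_le_enorm u v : dot u v <= enorm u * enorm v.
Proof.
have [->|v0] := eqVneq v 0.
  by rewrite enorm0 mulr0 -(scale0r 0) dotZr mul0r.
have v_gt0 : 0 < enorm v by rewrite lt_neqAle eq_sym enorm_eq0 v0 enorm_ge0.
apply: le_trans (ler_norm _) _.
rewrite -(@ler_pXn2r _ 2)// ?nnegrE ?mulr_ge0 ?enorm_ge0//.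
rewrite real_normK ?num_real// exprMn !enorm_sqr.
(* This vector is [dot v v] times the component of [u] orthogonal to [v]; its squared norm factors
   as [p * (q * p - r ^+ 2)], which is Cauchy-Schwarz. *)
have := dotvv_ge0 (dot v v *: u - dot u v *: v).
rewrite dotBl !dotDr !dotNr !dotZl !dotZr (dotC v u).
have : 0 < dot v v by rewrite -enorm_sqr exprn_gt0.
set p := dot v v; set q := dot u u; set r := dot u v => p0.
rewrite [X in 0 <= X -> _](_ : _ = p * (q * p - r ^+ 2)); last by ring.
by rewrite pmulr_rge0// subr_ge0.
Qed.

Lemma dot_ge_enorm u v : - (enorm u * enorm v) <= dot u v.
Proof. by rewrite lerNl -dotNl (le_trans (dot_le_enorm _ _))// enormN. Qed.

Lemma enorm_sqrD u v : enorm (u + v) ^+ 2 = enorm u ^+ 2 + 2 * dot u v + enorm v ^+ 2.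
Proof. by rewrite !enorm_sqr dotDl !dotDr (dotC v u); ring. Qed.

Lemma enormD u v : enorm (u + v) <= enorm u + enorm v.
Proof.
rewrite -(@ler_pXn2r _ 2)// ?nnegrE ?addr_ge0 ?enorm_ge0//.
by rewrite enorm_sqrD; have := dot_le_enorm u v; lra.
Qed.

Lemma coord_le_enorm u i : `|u ord0 i| <= enorm u.
Proof.
rewrite -(@ler_pXn2r _ 2)// ?nnegrE ?enorm_ge0// real_normK ?num_real//.
rewrite enorm_sqr /dot (bigD1 i)//= -expr2 lerDl.
by apply: sumr_ge0 => j _; rewrite -expr2 sqr_ge0.
Qed.

(** Makes Euclidean balls bounded for the sup norm, hence compact once closed. *)
Lemma norm_le_enorm u : `|u| <= enorm u.
Proof.
rewrite /Num.Def.normr/= mx_normrE; apply: bigmax_le; first exact: enorm_ge0.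
by move=> [i j] _/=; rewrite ord1; exact: coord_le_enorm.
Qed.

Lemma dot_continuous (T : topologicalType) (F G : T -> 'rV[R]_n) x :
  {for x, continuous F} -> {for x, continuous G} ->
  {for x, continuous (fun z => dot (F z) (G z))}.
Proof.
move=> cF cG.
rewrite /prop_for /continuous_at /dot.
apply: cvg_big; first exact: add_continuous.
move=> i _.
apply: cvgM.
  exact: (@continuous_comp _ _ _ F (fun v : 'rV[R]_n => v ord0 i) x cF (@coord_continuous _ _ _ _ _ _)).
exact: (@continuous_comp _ _ _ G (fun v : 'rV[R]_n => v ord0 i) x cG (@coord_continuous _ _ _ _ _ _)).
Qed.

Lemma enorm_continuous : continuous (@enorm R n).
Proof.
move=> x; have : @enorm R n = Num.sqrt \o (fun z => dot z z).
  by apply/funext => z /=; rewrite -enorm_sqr sqrtr_sqr ger0_norm ?enorm_ge0.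
move=> ->; apply: continuous_comp; last exact: sqrt_continuous.
by apply: dot_continuous; exact: cvg_id.
Qed.

Lemma enormB_continuous v : continuous (fun u => enorm (u - v)).
Proof.
move=> u; apply: (@continuous_comp _ _ _ (fun u => u - v) (@enorm R n)).
  by apply: (@continuousB R 'rV[R]_n 'rV[R]_n id (cst v)); [exact: cvg_id|exact: cst_continuous].
exact: enorm_continuous.
Qed.

End euclidean.

(** * Smoothness and the Polyak-Lojasiewicz inequality *)

(** The right-hand side tends to 0 with [u]. It serves [max_y f], which is controlled only through
    quadratic estimates. *)
Lemma continuous_quadratic_bound (R : realType) (T : topologicalType)
    (g u : T -> R) (a b : R) (x : T) :
  {for x, continuous u} -> u x = 0 ->
  (forall z, `|g x - g z| <= a * u z + b * (u z * u z)) -> {for x, continuous g}.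
Proof.
move=> cu u0 gB; pose B := (cst a * u) + (cst b * (u * u)).
have cB : {for x, continuous B}.
  by apply: continuousD; apply: continuousM; try exact: cst_continuous; try apply: continuousM.
have B0 : B x = 0 by rewrite /B !fctE u0 !mulr0 addr0.
apply/cvgrPdist_le => e e0.
have := cB; move/cvgrPdist_le => /(_ e e0); rewrite B0; apply: filterS => z.
by rewrite sub0r normrN; apply: le_trans; exact: le_trans (gB z) (ler_norm _).
Qed.

Section descent.
Context {R : realType} {n : nat}.
Implicit Types (h : 'rV[R]_n -> R) (z d : 'rV[R]_n).

Lemma derive_gradient h z d : differentiable h z -> 'D_d h z = dot (gradient h z) d.
Proof.
move=> dh; rewrite deriveE// {1}(row_sum_delta d) linear_sum/=.
by apply: eq_bigr => i _; rewrite linearZ/= mxE deriveE// mulrC.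
Qed.

Lemma is_derive_line h z d (t : R) : differentiable h (t *: d + z) ->
  is_derive t 1 (fun s : R => h (s *: d + z)) (dot (gradient h (t *: d + z)) d).
Proof.
move=> dh.
have E : (fun s : R => s^-1 *: (((fun s : R => h (s *: d + z)) \o shift t) (s *: 1) - h (t *: d + z)))
  = (fun s : R => s^-1 *: ((h \o shift (t *: d + z)) (s *: d) - h (t *: d + z))).
  by apply/funext => s /=; rewrite [s *: 1]mulr1 scalerDl addrA.
have dd := @diff_derivable _ _ _ h _ d dh.
apply: DeriveDef; first by rewrite /derivable E; exact: dd.
by rewrite -derive_gradient// /derive E.
Qed.

(** The difference of [phi] and [a * t + b * t ^+ 2] has nonpositive derivative on [[0, 1]], so the
    mean value theorem applies to it. *)
Lemma quadratic_growth (phi dphi : R -> R) (a b : R) :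
  (forall t, is_derive t (1 : R) phi (dphi t)) ->
  (forall t, 0 <= t -> dphi t <= a + 2 * t * b) ->
  phi 1 <= phi 0 + a + b.
Proof.
move=> dp le_dphi.
pose psi : R -> R := phi - (a \*: id + b \*: (id ^+ 2)).
have psiE t : psi t = phi t - (a * t + b * t ^+ 2) by [].
have dpsi t : is_derive t (1 : R) psi (dphi t - (a + 2 * t * b)).
  have dpt := dp t; apply: is_derive_eq.
  by rewrite /GRing.scale/= expr1; ring.
have cpsi : {within `[0, 1], continuous psi}.
  by apply: derivable_within_continuous => x _; exact: ex_derive.
have [c] := MVT ltr01 (fun x _ => dpsi x) cpsi.
rewrite in_itv/= => /andP[c0 _].
rewrite !psiE expr0n expr1n !mulr0 !mulr1 addr0 !subr0.
have := le_dphi c (ltW c0); lra.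
Qed.

(** Along the segment from [z] to [z + d] the derivative of [h] stays within [t * l * enorm d ^+ 2]
    of its initial value, by Cauchy-Schwarz. [quadratic_growth] is then used for [- h] and for
    [h]. *)
Lemma smooth_bound h (l : R) : (forall z, differentiable h z) ->
  (forall z z', enorm (gradient h z - gradient h z') <= l * enorm (z - z')) ->
  forall z d, `|h (z + d) - h z - dot (gradient h z) d| <= l / 2 * enorm d ^+ 2.
Proof.
move=> dh lh z d.
have lip t : 0 <= t ->
    `|dot (gradient h (t *: d + z)) d - dot (gradient h z) d| <= t * l * enorm d ^+ 2.
  move=> t0; rewrite -dotBl.
  set g := _ - _; have : enorm g <= l * (t * enorm d).
    by rewrite (le_trans (lh _ _))// addrK enormZ ger0_norm.
  have := enorm_ge0 d; have := dot_le_enorm g d; have := dot_ge_enorm g d.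
  by rewrite ler_norml; nra.
have H := fun t => @is_derive_line h z d t (dh _).
rewrite ler_norml; apply/andP; split.
- have /(_ (- dot (gradient h z) d) (l / 2 * enorm d ^+ 2)) :=
    @quadratic_growth (fun t => - h (t *: d + z)) _ _ _ (fun t => is_deriveN (H t)).
  rewrite scale1r scale0r add0r (addrC d) => {}H.
  have : - h (z + d) <= - h z - dot (gradient h z) d + l / 2 * enorm d ^+ 2.
    by apply: H => t /lip; rewrite ler_norml; lra.
  lra.
- have /(_ (dot (gradient h z) d) (l / 2 * enorm d ^+ 2)) :=
    @quadratic_growth (fun t => h (t *: d + z)) _ _ _ H.
  rewrite scale1r scale0r add0r (addrC d) => {}H.
  have : h (z + d) <= h z + dot (gradient h z) d + l / 2 * enorm d ^+ 2.
    by apply: H => t /lip; rewrite ler_norml; lra.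
  lra.
Qed.

(* The minimiser of sqrt h + c * dist(., y) is a zero of h: elsewhere the PL
   inequality lets a short gradient step decrease sqrt h at slope close to
   sqrt (mu / 2) > c. *)
Lemma PL_error_bound h (G : 'rV[R]_n -> 'rV[R]_n) (l mu c : R) (y : 'rV[R]_n) :
  0 < l -> 0 < c -> 2 * c ^+ 2 < mu ->
  continuous h -> (forall z, 0 <= h z) ->
  (forall z d, h (z + d) <= h z + dot (G z) d + l / 2 * enorm d ^+ 2) ->
  (forall z, 2 * mu * h z <= enorm (G z) ^+ 2) ->
  exists2 z, h z = 0 & c ^+ 2 * enorm (z - y) ^+ 2 <= h y.
Proof.
move=> l0 c0 cmu ch h0 hs hPL.
pose phi z := Num.sqrt (h z) + c * enorm (z - y).
(* Beyond this radius the distance term of [phi] alone exceeds [phi y], so a minimum over the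
   compact ball [K] is a global one. *)
pose r := Num.sqrt (h y) / c + 1.
pose K := [set z : 'rV[R]_n | enorm (z - y) <= r].
have csqrt : continuous (Num.sqrt \o h).
  by move=> z; apply: continuous_comp; [exact: ch|exact: sqrt_continuous].
have cphi : continuous phi.
  move=> z; apply: (@continuousD _ _ _ (Num.sqrt \o h) (fun z => c * enorm (z - y))).
    exact: csqrt.
  by apply: (@continuousM _ _ (cst c)); [exact: cst_continuous|exact: enormB_continuous].
have r0 : 0 <= r by rewrite addr_ge0// divr_ge0 ?sqrtr_ge0// ltW.
have Ky : K y by rewrite /K/= subrr enorm0.
have [|||z0 z0K min0] := @EVT_min_rV R n phi K.
- by exists y.
- apply: bounded_closed_compact.
    exists (r + enorm y); split; first exact: num_real.
    move=> M rM z /= Kz; apply: le_trans (norm_le_enorm _) _.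
    rewrite -(subrK y z) (le_trans (enormD _ _))// ltW// (le_lt_trans _ rM)//.
    by rewrite lerD2r.
  apply: (@preimage_closed _ _ (fun z => enorm (z - y)) [set x | x <= r]); last exact: closed_le.
  by move=> x _; exact: enormB_continuous.
- exact: continuous_subspaceT.
have phi_y : phi z0 <= Num.sqrt (h y).
  have := min0 y; rewrite inE => /(_ Ky); rewrite {2}/phi subrr enorm0 mulr0 addr0.
  exact.
have gmin z : phi z0 <= phi z.
  have [zK|zK] := leP (enorm (z - y)) r; first by apply: min0; rewrite inE.
  apply: (le_trans phi_y); have : c * r <= c * enorm (z - y) by rewrite ler_pM2l// ltW.
  rewrite /r mulrDr mulrCA divff ?gt_eqF// /phi; have := sqrtr_ge0 (h z); lra.
exists z0; last first.
  have : c * enorm (z0 - y) <= Num.sqrt (h y).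
    by have := sqrtr_ge0 (h z0); have := phi_y; rewrite /phi; lra.
  rewrite -(@ler_pXn2r _ 2)// ?nnegrE ?sqrtr_ge0 ?mulr_ge0 ?enorm_ge0 ?(ltW c0)//.
  by rewrite exprMn (sqr_sqrtr (h0 y)).
apply/eqP; rewrite eq_le h0 andbT leNgt; apply/negP => hz0.
set s := Num.sqrt (h z0).
have s0 : 0 < s by rewrite sqrtr_gt0.
have s2 : s ^+ 2 = h z0 by rewrite sqr_sqrtr.
set e := enorm (G z0).
have mu0 : 0 < mu by have : 0 < c ^+ 2 := exprn_gt0 2 c0; lra.
(* The PL inequality and [2 * c ^+ 2 < mu] give [e ^+ 2 >= 2 * mu * s ^+ 2 > (2 * c * s) ^+ 2]. *)
have es : 2 * c * s < e.
  rewrite -(@ltr_pXn2r _ 2)// ?nnegrE ?enorm_ge0 ?mulr_ge0 ?(ltW c0) ?(ltW s0)//.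
  apply: lt_le_trans (hPL z0); rewrite -s2 !exprMn.
  have : 0 < s ^+ 2 := exprn_gt0 2 s0; nra.
have e0 : 0 < e by apply: lt_trans es; rewrite !mulr_gt0.
(* The step size for which (1 - l eta / 2) e = e / 2 + c s > 2 c s. *)
pose eta := (e - 2 * c * s) / (l * e).
have eta0 : 0 < eta by rewrite divr_gt0 ?subr_gt0 ?mulr_gt0.
have etaE : eta * l * e = e - 2 * c * s by rewrite /eta; field; rewrite !gt_eqF.
have := gmin (z0 + - (eta *: G z0)).
have := hs z0 (- (eta *: G z0)).
rewrite dotNr dotZr enormN enormZ -enorm_sqr ger0_norm ?(ltW eta0)//.
rewrite -/e -s2 => h1.
set z1 := z0 + _ in h1 *.
have : enorm (z1 - y) <= enorm (z0 - y) + eta * e.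
  rewrite /z1 addrAC (le_trans (enormD _ _))// enormN enormZ.
  by rewrite ger0_norm ?(ltW eta0).
rewrite /phi -/s; set s1 := Num.sqrt (h z1).
have s10 : 0 <= s1 by rewrite sqrtr_ge0.
have s12 : s1 ^+ 2 = h z1 by rewrite sqr_sqrtr.
move=> h2 h3.
have {h2}h3 : s - c * eta * e <= s1.
  by move: h3; have := ler_wpM2l (ltW c0) h2; lra.
have h4 : s1 ^+ 2 <= s ^+ 2 - eta * e * (e / 2 + c * s).
  rewrite s12; apply: le_trans h1 _; rewrite exprMn.
  have -> : l / 2 * (eta ^+ 2 * e ^+ 2) = (eta * l * e) * (eta * e / 2) by field.
  rewrite etaE; nra.
have h5 : 0 < eta * e by rewrite mulr_gt0.
have h6 : 2 * (c * s) * (eta * e) < eta * e * (e / 2 + c * s).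
  by rewrite mulrC ltr_pM2l//; lra.
(* Minimality yields [s1 ^+ 2 >= 2 * s * s1 - s ^+ 2 >= s ^+ 2 - 2 * c * s * eta * e], while [h4]
   and [h6] put [s1 ^+ 2] strictly below that. *)
have : 0 <= (s1 - s) ^+ 2 by rewrite sqr_ge0.
have h7 : s * (s - c * eta * e) <= s * s1 by rewrite ler_pM2l.
nra.
Qed.

End descent.

(** * The primal function max_y f *)

Section primal_function.
Context {R : realType} {d1 d2 : nat}.
Variables (f : 'rV[R]_d1 -> 'rV[R]_d2 -> R) (l mu1 mu2 : R).
Hypotheses (l0 : 0 < l) (mu20 : 0 < mu2).
Hypothesis f_diff : forall z : 'rV[R]_d1 * 'rV[R]_d2,
  differentiable (fun u : 'rV[R]_d1 * 'rV[R]_d2 => f u.1 u.2) z.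
Hypothesis f_lip : lipschitz_gradient f l.
Hypothesis f_saddle : saddle_point_assumption f.
Hypothesis f_PL : two_sided_PL f mu1 mu2.

Implicit Types (x : 'rV[R]_d1) (y : 'rV[R]_d2).

Lemma continuous_uncurried : continuous (fun u : 'rV[R]_d1 * 'rV[R]_d2 => f u.1 u.2).
Proof. by move=> z; exact: differentiable_continuous. Qed.

Lemma differentiable_l y x : differentiable (f ^~ y) x.
Proof.
apply: (@differentiable_comp _ _ _ _ (fun x => (x, y)) (fun u : 'rV[R]_d1 * 'rV[R]_d2 => f u.1 u.2)).
  by apply: differentiable_pair.
exact: f_diff.
Qed.

Lemma differentiable_r x y : differentiable (f x) y.
Proof.
apply: (@differentiable_comp _ _ _ _ (fun y => (x, y)) (fun u : 'rV[R]_d1 * 'rV[R]_d2 => f u.1 u.2)).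
  by apply: differentiable_pair.
exact: f_diff.
Qed.

Lemma smooth_l x y d :
  `|f (x + d) y - f x y - dot (grad_x f x y) d| <= l / 2 * enorm d ^+ 2.
Proof.
apply: (@smooth_bound _ _ (f ^~ y)) => [z|z z']; first exact: differentiable_l.
by have [+ _] := f_lip z z' y y; rewrite subrr enorm0 addr0.
Qed.

Lemma smooth_r x y d :
  `|f x (y + d) - f x y - dot (grad_y f x y) d| <= l / 2 * enorm d ^+ 2.
Proof.
apply: (@smooth_bound _ _ (f x)) => [z|z z']; first exact: differentiable_r.
by have [_ +] := f_lip x x z z'; rewrite subrr enorm0 add0r.
Qed.

Lemma max_yP x : exists2 y, max_y f x = f x y & forall y', f x y' <= f x y.
Proof.
have [_ _ /(_ x) [y hy]] := f_saddle; exists y => //.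
apply/eqP; rewrite eq_le; apply/andP; split.
  by apply: ge_sup => [|_ [y' _ <-]]; [exists (f x y), y|exact: hy].
by apply: ub_le_sup; [exists (f x y) => _ [y' _ <-]; exact: hy|exists y].
Qed.

Lemma le_max_y x y : f x y <= max_y f x.
Proof. by have [y' -> ] := max_yP x. Qed.

Lemma min_xP y : exists2 x, min_x f y = f x y & forall x', f x y <= f x' y.
Proof.
have [_ /(_ y) [x hx] _] := f_saddle; exists x => //.
apply/eqP; rewrite eq_le; apply/andP; split.
  by apply: ge_inf; [exists (f x y) => _ [x' _ <-]; exact: hx|exists x].
by apply: lb_le_inf => [|_ [x' _ <-]]; [exists (f x y), x|exact: hx].
Qed.

Lemma max_y_lb : has_lbound (range (max_y f)).
Proof.
have [[xs [ys hs]] _ _] := f_saddle.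
exists (f xs ys) => _ [x _ <-]; apply: le_trans (le_max_y x ys).
by have [] := hs x ys.
Qed.

Lemma minmax_le x : minmax f <= max_y f x.
Proof. by apply: ge_inf; [exact: max_y_lb|exists x]. Qed.

(** Weak duality: [min_x f y <= f x' y <= max_y f x'] for every [x']. *)
Lemma min_x_le_minmax y : min_x f y <= minmax f.
Proof.
have [x -> hx] := min_xP y.
apply: lb_le_inf => [|_ [x' _ <-]]; first by exists (max_y f 0), 0.
exact: le_trans (hx x') (le_max_y _ _).
Qed.

Let gap x y := max_y f x - f x y.

Lemma gap_ge0 x y : 0 <= gap x y.
Proof. by rewrite subr_ge0 le_max_y. Qed.

(** [PL_error_bound] for [gap x], whose zeros are the maximisers of [f x]. The value
    [c ^+ 2 = mu2 / 2] is excluded, so a use either accepts a smaller constant or passes to the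
    limit. *)
Lemma maximizer_near c x y : 0 < c -> 2 * c ^+ 2 < mu2 ->
  exists2 y', max_y f x = f x y' & c ^+ 2 * enorm (y' - y) ^+ 2 <= gap x y.
Proof.
move=> c0 cmu.
have [|y'|y' d|y'|y' gy' le_y'] := @PL_error_bound R d2 (gap x) (fun y => - grad_y f x y) l mu2 c y l0 c0 cmu.
- move=> y'; apply: (@continuousB _ _ _ (cst (max_y f x)) (f x)).
    exact: cst_continuous.
  exact/differentiable_continuous/differentiable_r.
- exact: gap_ge0.
- by have := smooth_r x y' d; rewrite ler_norml dotNl /gap; lra.
- by rewrite enormN; have [_] := f_PL x y'.
- by exists y' => //; apply/eqP; rewrite -subr_eq0 -/(gap x y') gy'.
Qed.

(** An ascent step of size [l^-1] raises [f x] by at least the squared norm of the gradient over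
    [2 * l], which is impossible at a maximum unless the gradient vanishes. *)
Lemma grad_y_maximizer x y : max_y f x = f x y -> grad_y f x y = 0.
Proof.
move=> gxy; apply/eqP; rewrite -enorm_eq0; apply/eqP.
have li : 0 < l^-1 by rewrite invr_gt0.
have := smooth_r x y (l^-1 *: grad_y f x y).
rewrite dotZr -enorm_sqr enormZ (ger0_norm (ltW li)) exprMn.
have -> : l / 2 * (l^-1 ^+ 2 * enorm (grad_y f x y) ^+ 2) = l^-1 * (enorm (grad_y f x y) ^+ 2 / 2).
  by field; rewrite gt_eqF.
have := le_max_y x (y + l^-1 *: grad_y f x y); rewrite gxy.
set e := enorm _ => h /ler_normlP[h' _].
have : l^-1 * e ^+ 2 <= 0 by nra.
rewrite pmulr_rle0// => h2; apply/eqP; rewrite -sqrf_eq0 eq_le h2 sqr_ge0//.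
Qed.

(** The function [f ^~ y] lies below [max_y f] and touches it at [x], so its quadratic minorant is
    inherited. *)
Lemma max_y_ge x y x' : max_y f x = f x y ->
  max_y f x + dot (grad_x f x y) (x' - x) - l / 2 * enorm (x' - x) ^+ 2 <= max_y f x'.
Proof.
move=> gxy; have := smooth_l x y (x' - x); rewrite subrKC ler_norml gxy.
by have := le_max_y x' y; lra.
Qed.

(* Maximisers of f x move at most linearly with x, by the error bound. *)
Lemma max_y_le_weak x y : max_y f x = f x y -> exists M : R, forall x',
  max_y f x' <= max_y f x + dot (grad_x f x y) (x' - x) + M * enorm (x' - x) ^+ 2.
Proof.
move=> gxy.
(* Any [c ^+ 2] below [mu2 / 2] would do: [M] need not be sharp here. *)
pose c := Num.sqrt (mu2 / 4).
have mu240 : 0 < mu2 / 4 by rewrite divr_gt0.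
have c0 : 0 < c by rewrite sqrtr_gt0.
have c2 : c ^+ 2 = mu2 / 4 by rewrite (sqr_sqrtr (ltW mu240)).
exists (l * (2 * l / mu2) + l / 2) => x'.
have [|y' gy' hy'] := @maximizer_near c x' y c0; first by rewrite c2; lra.
have [_ PL'] := f_PL x' y.
have [_] := f_lip x' x y y; rewrite subrr enorm0 addr0 (grad_y_maximizer gxy) subr0 => lipy.
have lipx : enorm (grad_x f x y' - grad_x f x y) <= l * enorm (y' - y).
  by have [+ _] := f_lip x x y' y; rewrite subrr enorm0 add0r.
have := smooth_l x y' (x' - x); rewrite subrKC ler_norml.
have := le_max_y x y'.
have : dot (grad_x f x y') (x' - x) <= dot (grad_x f x y) (x' - x) + l * enorm (y' - y) * enorm (x' - x).
  by rewrite -lerBlDl -dotBl (le_trans (dot_le_enorm _ _))// ler_wpM2r// enorm_ge0.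
(* Error bound and PL inequality at [x'], then [lipy]. They give the factor [sqrt 2 * l / mu2],
   rounded up to avoid the root. *)
have : enorm (y' - y) <= 2 * l / mu2 * enorm (x' - x).
  rewrite -(@ler_pXn2r _ 2)// ?nnegrE ?enorm_ge0 ?mulr_ge0 ?invr_ge0 ?enorm_ge0 ?(ltW l0) ?(ltW mu20)//.
  rewrite -(@ler_pM2l _ (mu2 ^+ 2 / 2)); last by rewrite divr_gt0// exprn_gt0.
  have -> : mu2 ^+ 2 / 2 * (2 * l / mu2 * enorm (x' - x)) ^+ 2 = 2 * (l * enorm (x' - x)) ^+ 2.
    by field; rewrite gt_eqF.
  have : enorm (grad_y f x' y) ^+ 2 <= (l * enorm (x' - x)) ^+ 2.
    by rewrite ler_pXn2r// ?nnegrE ?enorm_ge0// mulr_ge0 ?enorm_ge0 ?(ltW l0).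
  move: hy' PL'; rewrite c2 -/(gap x' y).
  move=> h1 h2 h3.
  have : 2 * mu2 * (mu2 / 4 * enorm (y' - y) ^+ 2) <= 2 * mu2 * gap x' y.
    by rewrite ler_pM2l// mulr_gt0.
  by have := sqr_ge0 (l * enorm (x' - x)); lra.
set e := enorm (y' - y); set d := enorm (x' - x) => h1 h2 h3 /andP[_ h4].
have d0 : 0 <= d := enorm_ge0 _.
have := ler_wpM2l (ltW l0) (ler_wpM2r d0 h1).
rewrite gy'; lra.
Qed.

(** The quadratic minorant built on [y2] lies below the majorant built on [y1] and both touch
    [max_y f] at [x], so their linear parts agree. *)
Lemma grad_x_maximizer x y1 y2 : max_y f x = f x y1 -> max_y f x = f x y2 ->
  grad_x f x y1 = grad_x f x y2.
Proof.
move=> g1 g2; have [M hM] := max_y_le_weak g1.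
apply/eqP; rewrite eq_sym -subr_eq0 -enorm_eq0; apply/eqP.
set v := grad_x f x y2 - grad_x f x y1.
have key t : t * enorm v ^+ 2 <= (M + l / 2) * (t ^+ 2 * enorm v ^+ 2).
  have := hM (x + t *: v); have := max_y_ge (x + t *: v) g2.
  rewrite (addrAC x) subrr add0r enormZ exprMn real_normK ?num_real// !dotZr.
  by rewrite enorm_sqr {2 5}/v dotBl; lra.
(* With [K] positive and above [M + l / 2], the choice [t = K^-1] in [key] makes the linear term
   dominate and forces [v = 0]. *)
pose K := `|M + l / 2| + 1.
have K0 : 0 < K by rewrite ltr_wpDl.
have h1 : M + l / 2 < K by rewrite /K (le_lt_trans (ler_norm _))// ltrDl.
apply/eqP; rewrite -sqrf_eq0 eq_le sqr_ge0 andbT.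
have := key K^-1.
have Ki : 0 < K^-1 by rewrite invr_gt0.
rewrite -subr_ge0.
have -> : (M + l / 2) * (K^-1 ^+ 2 * enorm v ^+ 2) - K^-1 * enorm v ^+ 2 =
  (K^-1 ^+ 2 * (K - (M + l/2))) * - enorm v ^+ 2.
  by field; rewrite gt_eqF.
by rewrite pmulr_rge0 ?oppr_ge0// mulr_gt0 ?exprn_gt0// subr_gt0.
Qed.

(** Danskin's formula for the gradient of [max_y f]. The maximiser is picked by choice;
    [grad_max_yE] shows that the pick does not matter. *)
Definition grad_max_y x : 'rV[R]_d1 := grad_x f x (projT1 (cid2 (max_yP x))).

Lemma grad_max_yE x y : max_y f x = f x y -> grad_max_y x = grad_x f x y.
Proof.
by rewrite /grad_max_y; case: (cid2 _) => y' /= h _; exact: grad_x_maximizer.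
Qed.

(** For each [m < mu2] a maximiser near [y] gives the bound with [m] in place of [mu2]; the sharp
    constant follows by letting [m] approach [mu2]. *)
Lemma grad_max_y_gap x y :
  mu2 * enorm (grad_x f x y - grad_max_y x) ^+ 2 <= 2 * l ^+ 2 * gap x y.
Proof.
apply/ler_addgt0Pr => e e0.
set p := enorm _.
have [->|p0] := eqVneq p 0.
  by rewrite expr0n mulr0 addr_ge0 ?(ltW e0)// !mulr_ge0 ?gap_ge0 ?(ltW l0).
have p2 : 0 < p ^+ 2 by rewrite exprn_even_gt0.
have mu2h : mu2 / 2 < mu2 by rewrite ltr_pdivrMr// mulr_natr mulr2n ltrDl.
(* The second term makes the loss [(mu2 - m) * p ^+ 2] at most [e]; the first keeps [m] positive. *)
pose m := Num.max (mu2 / 2) (mu2 - e / p ^+ 2).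
have m0 : 0 < m by rewrite lt_max divr_gt0.
have mmu : m < mu2 by rewrite gt_max; apply/andP; split; [exact: mu2h|rewrite ltrBlDr ltrDl divr_gt0].
have m20 : 0 < m / 2 by rewrite divr_gt0.
have c0 : 0 < Num.sqrt (m / 2) by rewrite sqrtr_gt0.
have c2 : Num.sqrt (m / 2) ^+ 2 = m / 2 by rewrite (sqr_sqrtr (ltW m20)).
have [|y' gy' hy'] := @maximizer_near _ x y c0; first by rewrite c2; lra.
have : p <= l * enorm (y' - y).
  rewrite /p (grad_max_yE gy').
  by have [+ _] := f_lip x x y y'; rewrite subrr enorm0 add0r (enormB y).
rewrite -(@ler_pXn2r _ 2)// ?nnegrE ?enorm_ge0 ?mulr_ge0 ?enorm_ge0 ?(ltW l0)// exprMn => h.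
have : mu2 * p ^+ 2 <= m * p ^+ 2 + e.
  have : mu2 - e / p ^+ 2 <= m by rewrite le_max lexx orbT.
  by rewrite lerBlDr -(ler_pM2r p2) mulrDl divfK ?gt_eqF.
move: hy'; rewrite c2 => hy' h1.
have : m * p ^+ 2 <= 2 * l ^+ 2 * gap x y; last by lra.
have := ler_wpM2l (ltW m0) h.
have : 2 * l ^+ 2 * (m / 2 * enorm (y' - y) ^+ 2) <= 2 * l ^+ 2 * gap x y.
  by rewrite ler_wpM2l// mulr_ge0// sqr_ge0.
lra.
Qed.

(* Expand f (., y') at x, for y' a maximiser of f x': the loss gap x y' >= 0
   pays for replacing grad_x f x y' by the gradient of max_y f, by AM-GM. *)
Lemma max_y_smooth x x' : max_y f x' <=
  max_y f x + dot (grad_max_y x) (x' - x) + (l + l ^+ 2 / mu2) / 2 * enorm (x' - x) ^+ 2.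
Proof.
have [y' gy' _] := max_yP x'.
have := grad_max_y_gap x y'; have := smooth_l x y' (x' - x).
rewrite subrKC ler_norml gy' /gap => /andP[_].
have -> : grad_x f x y' = (grad_x f x y' - grad_max_y x) + grad_max_y x by rewrite subrK.
rewrite dotDl addrK; set w := _ - grad_max_y x.
have := dot_le_enorm w (x' - x).
set e := enorm w; set d := enorm (x' - x); set D := dot w _; set D' := dot _ _.
move=> h1 h2 h3.
(* The weight on [e ^+ 2] is the one that [grad_max_y_gap] turns into exactly one gap; the other
   weight is the extra [l ^+ 2 / mu2] in the smoothness constant. *)
have : e * d <= mu2 / (2 * l ^+ 2) * e ^+ 2 + l ^+ 2 / mu2 / 2 * d ^+ 2.
  rewrite -subr_ge0.
  have -> : mu2 / (2 * l ^+ 2) * e ^+ 2 + l ^+ 2 / mu2 / 2 * d ^+ 2 - e * d =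
      (mu2 / (2 * l ^+ 2)) * (e - l ^+ 2 / mu2 * d) ^+ 2.
    by field; rewrite !gt_eqF.
  by rewrite mulr_ge0 ?sqr_ge0// divr_ge0 ?(ltW mu20)// mulr_ge0 ?sqr_ge0.
have : mu2 / (2 * l ^+ 2) * e ^+ 2 <= max_y f x - f x y'.
  have l20 : 0 < 2 * l ^+ 2 by rewrite mulr_gt0 ?exprn_gt0.
  by rewrite mulrAC ler_pdivrMr// [leRHS]mulrC.
lra.
Qed.

(** The PL inequality of [f ^~ y] at a maximiser [y] of [f x], with [min_x f y] replaced by the
    larger [minmax f]. *)
Lemma grad_max_y_PL x : 0 < mu1 -> 2 * mu1 * (max_y f x - minmax f) <= enorm (grad_max_y x) ^+ 2.
Proof.
move=> mu10; have [y gy _] := max_yP x; rewrite (grad_max_yE gy).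
have [+ _] := f_PL x y; apply: le_trans.
rewrite ler_pM2l ?mulr_gt0// gy lerD2l lerN2; exact: min_x_le_minmax.
Qed.

Lemma max_y_continuous : continuous (max_y f).
Proof.
move=> x0; pose x : 'rV[R]_d1 := x0; have [y gy _] := max_yP x.
pose v := grad_x f x y.
pose q := l ^+ 2 / mu2.
have q0 : 0 <= q by rewrite divr_ge0 ?sqr_ge0 ?(ltW mu20).
apply: (@continuous_quadratic_bound R 'rV[R]_d1 (max_y f) (fun z => enorm (z - x)) (enorm v) (l + q) x).
- exact: enormB_continuous.
- by rewrite subrr enorm0.
move=> x'; rewrite -expr2.
have := max_y_smooth x x'; have := max_y_ge x' gy.
rewrite (grad_max_yE gy) -/v -/q.
have := dot_le_enorm v (x' - x); have := dot_ge_enorm v (x' - x).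
set d := enorm (x' - x); set D := dot _ _; set E := enorm v * d.
move=> h1 h2 h3 h4; have : 0 <= l * d ^+ 2 by rewrite mulr_ge0 ?sqr_ge0 ?(ltW l0).
have : 0 <= q * d ^+ 2 by rewrite mulr_ge0 ?sqr_ge0.
by rewrite ler_norml; lra.
Qed.

End primal_function.

(** * Measurability on row vectors *)

Section measurable_row_lemmas.
Context d (T : measurableType d) d' (U : measurableType d') (n : nat).

Lemma measurable_coord (i : 'I_n) :
  measurable_fun setT (fun v : 'rV[U]_n => v ord0 i).
Proof.
move=> _ Y mY; rewrite setTI; apply: sub_sigma_algebra => /=.
rewrite -bigcup_seq/=; exists i => /=; first by rewrite mem_index_enum.
by exists Y => //; rewrite setTI.
Qed.

Lemma measurable_fun_row (h : T -> 'rV[U]_n) :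
  (forall i, measurable_fun setT (fun t => h t ord0 i)) -> measurable_fun setT h.
Proof.
move=> mh; apply: (@measurability _ _ _ _ _ _
  (\big[setU/set0]_(i < n) preimage_set_system setT (fun v : 'rV[U]_n => v ord0 i) measurable)) => //.
move=> _ [B + <-]; rewrite -bigcup_seq => -[i _ [C mC <-]].
rewrite setTI -comp_preimage.
by have := mh i measurableT C mC; rewrite !setTI.
Qed.

End measurable_row_lemmas.

Lemma measurable_axpy (R : realType) d (T : measurableType d) n (u v : T -> 'rV[R]_n) (a : R) :
  measurable_fun setT u -> measurable_fun setT v ->
  measurable_fun setT (fun w => u w + a *: v w).
Proof.
move=> mu mv; apply: measurable_fun_row => i; under eq_fun do rewrite !mxE.
apply: measurable_funD; first exact: (measurableT_comp (@measurable_coord _ _ _ i) mu).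
by apply: measurable_funM => //; exact: (measurableT_comp (@measurable_coord _ _ _ i) mv).
Qed.

(** Each preimage is a countable union of fibres of [p], so [h] may be arbitrary. *)
Lemma measurable_countable_fibers d (T : measurableType d) (I : countType)
    d' (U : measurableType d') (p : T -> I) (h : I -> U) :
  (forall i, measurable (p @^-1` [set i])) -> measurable_fun setT (h \o p).
Proof.
move=> mp _ A mA; rewrite setTI.
rewrite (_ : _ @^-1` _ = \bigcup_i (if `[< A (h i) >] then p @^-1` [set i] else set0)).
  apply: countable_bigcupT_measurable => // i; by case: ifP.
apply/seteqP; split => [t /= At|t [i _]].
  by exists (p t) => //; rewrite ifT//; exact/asboolP.
by case: ifPn => // /asboolP Ai /= pt; rewrite /preimage/= pt.
Qed.

(** * Continuous functions as limits of lattice step functions *)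

Section continuous_measurable.
Context {R : realType}.

(** Coordinates are rounded down to a lattice of mesh [1 / k.+1]; integer indices make the range
    countable. *)
Definition grid n (k : nat) (v : 'rV[R]_n) : 'rV[int]_n :=
  map_mx (fun a => Num.floor (a * k.+1%:R)) v.

Definition ungrid n (k : nat) (m : 'rV[int]_n) : 'rV[R]_n :=
  map_mx (fun a : int => a%:~R / k.+1%:R) m.

Lemma measurable_grid n k (m : 'rV[int]_n) : measurable (grid k @^-1` [set m]).
Proof.
rewrite (_ : _ @^-1` _ = \big[setI/setT]_(i <- index_enum 'I_n)
  ((fun v : 'rV[R]_n => v ord0 i * k.+1%:R) @^-1` `[(m ord0 i)%:~R, (m ord0 i + 1)%:~R[)).
  apply: bigsetI_measurable => i _.
  rewrite -[X in measurable X]setTI.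
  have mi : measurable_fun setT (fun v : 'rV[R]_n => v ord0 i * k.+1%:R).
    by apply: measurable_funM => //; exact: measurable_coord.
  by apply: mi => //; exact: measurable_itv.
rewrite -bigcap_seq; apply/seteqP; split => [v /= <- i _ /=|v /= h].
  by rewrite in_itv/= mxE; exact: floor_itv.
apply/rowP => i; rewrite mxE.
have /= := h i (mem_index_enum _); rewrite in_itv/=.
by move=> /floor_def.
Qed.

Lemma cvg_grid n (v : 'rV[R]_n) : (ungrid k (grid k v)) @[k --> \oo] --> v.
Proof.
apply/cvgrPdist_le => e e0; near=> k.
have k1 : k.+1%:R^-1 <= e.
  near: k; have := @cvg_harmonic R => /cvgrPdist_le /(_ _ e0).
  apply: filterS => k; rewrite sub0r normrN; apply: le_trans; exact: ler_norm.
rewrite /Num.Def.normr/= mx_normrE; apply: bigmax_le; first exact: ltW.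
move=> [i j] _/=; rewrite ord1 !mxE.
apply: le_trans k1.
set a := v ord0 j; have k0 : 0 < k.+1%:R :> R by [].
have kn0 : k.+1%:R != 0 :> R by rewrite gt_eqF.
rewrite -{1}(mulfK kn0 a) -mulrBl normrM normfV (ger0_norm (ltW k0)).
rewrite ler_pdivrMr// mulVf//.
have /andP[] := floor_itv (a * k.+1%:R).
by rewrite intrD; set q := (Num.floor _)%:~R; rewrite ler_norml; lra.
Unshelve. all: by end_near. Qed.

(** The sigma-algebra on rows is generated by coordinates, not by open sets, so [h] is obtained as
    the pointwise limit of its values at the lattice roundings. *)
Lemma continuous_row_measurable n (h : 'rV[R]_n -> R) :
  continuous h -> measurable_fun setT h.
Proof.
move=> ch; apply: (@measurable_fun_cvg _ _ _ _ (fun k => (h \o @ungrid n k) \o @grid n k)).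
  by move=> k; apply: measurable_countable_fibers => m; exact: measurable_grid.
move=> v _; have H : h (ungrid k (grid k v)) @[k --> \oo] --> h v.
  apply: (@cvg_comp _ _ _ (fun k => ungrid k (grid k v)) h); first exact: cvg_grid.
  exact: ch.
exact: H.
Qed.

Lemma continuous_row2_measurable n1 n2 (h : 'rV[R]_n1 * 'rV[R]_n2 -> R) :
  continuous h -> measurable_fun setT h.
Proof.
move=> ch; apply: (@measurable_fun_cvg _ _ _ _
  (fun k => (fun m => h (ungrid k m.1, ungrid k m.2)) \o (fun z => (grid k z.1, grid k z.2)))).
  move=> k; apply: measurable_countable_fibers => -[m1 m2].
  rewrite (_ : _ @^-1` _ = (grid k @^-1` [set m1]) `*` (grid k @^-1` [set m2])).
    by apply: measurableX; exact: measurable_grid.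
  by apply/seteqP; split => [[z1 z2]/= []|[z1 z2]/= [-> ->]].
suff H (v1 : 'rV[R]_n1) (v2 : 'rV[R]_n2) :
    h (ungrid k (grid k v1), ungrid k (grid k v2)) @[k --> \oo] --> h (v1, v2).
  by move=> [v1 v2] _; exact: H.
apply: (@cvg_comp _ _ _ (fun k => (ungrid k (grid k v1), ungrid k (grid k v2))) h _ (nbhs (v1, v2))).
  exact: (cvg_pair (@cvg_grid _ v1) (@cvg_grid _ v2)).
exact: ch.
Qed.

End continuous_measurable.

(** * Independence *)

Section independence.
Context {R : realType} dO (Omega : measurableType dO) (P : probability Omega R)
  dS (S : measurableType dS) (I : eqType) (X : I -> {RV P >-> S}).

(** Independence is tested on finite rectangles of the samples in [K], the form in which it can be
    propagated along the iteration. *)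
Definition independent_of_family d (T : measurableType d) (W : Omega -> T)
    (K : pred I) :=
  forall (s : seq I) (A : I -> set S) (C : set T), uniq s -> all K s ->
    (forall i, i \in s -> measurable (A i)) -> measurable C ->
    (P (W @^-1` C `&` \bigcap_(i in [set` s]) (X i @^-1` A i)) =
     P (W @^-1` C) * \prod_(i <- s) P (X i @^-1` A i))%E.

Lemma bigcap_preimage_measurable (s : seq I) (A : I -> set S) :
  (forall i, i \in s -> measurable (A i)) ->
  measurable (\bigcap_(i in [set` s]) (X i @^-1` A i)).
Proof.
move=> mA; apply: fin_bigcap_measurable => // i si.
by apply: measurable_funPTI; exact: mA.
Qed.

Lemma independent_cst d (T : measurableType d) (c : T) (K : pred I) :
  mutually_independent X -> independent_of_family (fun=> c) K.
Proof.
move=> indX s A C us _ mA _; rewrite preimage_cst; case: ifPn => _.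
  by rewrite setTI probability_setT mul1e indX.
by rewrite set0I measure0 mul0e.
Qed.

Section step.
Context d (T : measurableType d) (W : Omega -> T) (K : pred I) (k : I).
Hypotheses (mW : measurable_fun setT W) (Kk : K k) (indW : independent_of_family W K).

Lemma independent_pair (C : set T) (A : set S) : measurable C -> measurable A ->
  (P (W @^-1` C `&` X k @^-1` A) = P (W @^-1` C) * P (X k @^-1` A))%E.
Proof.
move=> mC mA; have := indW (s := [:: k]) (A := fun=> A) isT _ _ mC.
rewrite big_seq1 set_cons1 bigcap_set1.
by apply => //=; rewrite Kk.
Qed.

(** For a fixed event [B] on the remaining samples, the law of the pair restricted to [B] and [p]
    times the unrestricted law are finite measures. They agree on rectangles, a generating class
    stable under intersection, hence everywhere. *)
Lemma independent_step d' (T' : measurableType d') (Phi : T * S -> T')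
    (K' : pred I) : measurable_fun setT Phi -> {subset K' <= K} -> ~~ K' k ->
  independent_of_family (fun w => Phi (W w, X k w)) K'.
Proof.
move=> mPhi K'K K'k s A C us K's mA mC.
set B := \bigcap_(i in _) _.
have mB : measurable B by exact: bigcap_preimage_measurable.
set p := (\prod_(i <- s) _)%E.
have p0 : (0 <= p)%E by apply: prode_ge0 => i _; exact: measure_ge0.
have pfin : p \is a fin_num.
  rewrite /p big_seq; apply: prode_fin_num => i si.
  by apply: fin_num_measure; apply: measurable_funPTI; exact: mA.
pose r := NngNum (fine_ge0 p0).
have pE : p = (r%:num)%:E by rewrite fineK.
have mV : measurable_fun setT (fun w => (W w, X k w)) by exact: measurable_fun_pair.
pose m1 : {measure set (T * S) -> \bar R} :=
  measure_function_pushforward__canonical__measure_function_Measure (mrestr P mB) mV.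
pose m2 : {measure set (T * S) -> \bar R} :=
  mscale r (measure_function_pushforward__canonical__measure_function_Measure P mV).
suff mE D : measurable D -> m1 D = m2 D.
  have mD : measurable (Phi @^-1` C) by rewrite -[X in measurable X]setTI; exact: mPhi.
  have := mE _ mD; rewrite /m1 /m2/= /mscale/= /pushforward /mrestr.
  by rewrite -pE muleC.
apply: (measure_unique
  [set D | exists2 C, measurable C & exists2 A, measurable A & C `*` A = D] (fun=> setT)).
- by rewrite measurable_prod_measurableType.
- move=> _ _ [C1 mC1 [A1 mA1 <-]] [C2 mC2 [A2 mA2 <-]]; rewrite -setXI.
  exists (C1 `&` C2); first exact: measurableI.
  by exists (A1 `&` A2) => //; exact: measurableI.
- by move=> _; exists setT => //; exists setT => //; rewrite setXTT.
- by rewrite bigcup_const.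
- move=> _ [C1 mC1 [A1 mA1 <-]].
  rewrite /m1 /m2/= /mscale/= /pushforward /mrestr -pE.
  have -> : (fun w => (W w, X k w)) @^-1` (C1 `*` A1) = W @^-1` C1 `&` X k @^-1` A1 by [].
  rewrite independent_pair//.
  have ks : k \notin s by apply: contra K'k => /(allP K's).
  (* Since [k] is not in [s], the event on sample [k] can be appended to the family, and [indW]
     applied to [k :: s]. *)
  pose A' i := if i == k then A1 else A i.
  have A's i : i \in s -> A' i = A i.
    by rewrite /A'; case: eqP => // -> ; rewrite (negbTE ks).
  have -> : W @^-1` C1 `&` X k @^-1` A1 `&` B =
      W @^-1` C1 `&` \bigcap_(i in [set` k :: s]) (X i @^-1` A' i).
    have -> : [set` k :: s] = k |` [set` s].
      apply/seteqP; split => i /=; rewrite inE.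
        by case/predU1P; [left|right].
      by case=> [->|si]; apply/predU1P; [left|right].
    rewrite bigcap_setU1 {1}/A' eqxx setIA; congr (_ `&` _).
    by apply: eq_bigcapr => i /= /A's ->.
  rewrite indW//.
  + rewrite big_cons {1}/A' eqxx [RHS]muleC -muleA; congr (_ * (_ * _))%E.
    by apply: eq_big_seq => i /A's ->.
  + by rewrite /= ks.
  + by rewrite /= Kk/=; apply/allP => i /(allP K's); exact: K'K.
  + move=> i; rewrite inE /A'; case: eqP => //= _; exact: mA.
- move=> _; rewrite /m1/= /pushforward/mrestr.
  apply: le_lt_trans (ltry 1); apply: probability_le1.
  by rewrite preimage_setT setTI.
Qed.

(** The joint law of [W] and [X k] is the product of the law of [W] and [Q]. Tonelli needs only [F]
    nonnegative, so infinite values are allowed. *)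
Lemma integral_independent (Q : probability S R) (F : T * S -> \bar R) :
  (forall A, measurable A -> distribution P (X k) A = Q A) ->
  measurable_fun setT F -> (forall z, 0 <= F z)%E ->
  (\int[P]_w F (W w, X k w) = \int[P]_w \int[Q]_s F (W w, s))%E.
Proof.
move=> XQ mF F0.
pose V0 (w : Omega) : T * S := (W w, X k w).
have mV : measurable_fun setT V0 by exact: measurable_fun_pair.
pose V : {mfun Omega >-> (T * S)%type} := HB.pack V0 (isMeasurableFun.Build _ _ _ _ V0 mV).
pose W0 : {mfun Omega >-> T} := HB.pack W (isMeasurableFun.Build _ _ _ _ W mW).
rewrite -[LHS](@ge0_integral_distribution _ _ _ _ _ P V F)//.
rewrite (@eq_measure_integral _ _ _ _ (distribution P W0 \x Q)%E); last first.
  move=> D mD _; apply/esym; apply: product_measure_unique => // C A mC mA.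
  transitivity (distribution P W0 C * distribution P (X k) A)%E; last by rewrite XQ.
  exact: independent_pair.
rewrite fubini_tonelli1// (@ge0_integral_distribution _ _ _ _ _ P W0)//.
- exact: measurable_fun_fubini_tonelli_F.
- by move=> t; apply: integral_ge0.
Qed.

Lemma integral_independent_le (Q : probability S R) (F : T * S -> \bar R) (h : T -> R) :
  (forall A, measurable A -> distribution P (X k) A = Q A) ->
  measurable_fun setT F -> (forall z, 0 <= F z)%E -> measurable_fun setT h ->
  (forall u, \int[Q]_s F (u, s) <= (h u)%:E)%E ->
  (\int[P]_w F (W w, X k w) <= \int[P]_w (h (W w))%:E)%E.
Proof.
move=> XQ mF F0 mh Fh; rewrite (integral_independent XQ mF F0).
apply: ge0_le_integral => //.
- by move=> w _; apply: integral_ge0.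
- have mI : measurable_fun setT (fun u => \int[Q]_s F (u, s))%E.
    exact: measurable_fun_fubini_tonelli_F.
  exact: (measurableT_comp mI mW).
- by apply/measurable_EFinP; exact: measurableT_comp.
Qed.

End step.
End independence.

(** * Expected change of the potential in one step *)

Section mean.
Context {R : realType} d (S : measurableType d) (Q : probability S R).
Implicit Types (u v : S -> R) (a b : R).

Definition has_mean u a := Q.-integrable setT (EFin \o u) /\ (\int[Q]_s (u s)%:E = a%:E)%E.

(** A difference in [\bar R] is finite only if both terms are, so a finite integral makes those of
    the positive and negative parts finite, hence that of the absolute value. *)
Lemma has_mean_measurable u a : measurable_fun setT u ->
  (\int[Q]_s (u s)%:E = a%:E)%E -> has_mean u a.
Proof.
move=> mu ua; split => //.
have mEu : measurable_fun setT (EFin \o u) by exact/measurable_EFinP.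
apply/integrableP; split; first exact: mEu.
have := ua; rewrite integralE => uE.
have : ((\int[Q]_x ((fun s => (u s)%:E)^\+ x) - \int[Q]_x ((fun s => (u s)%:E)^\- x))%E \is a fin_num).
  by rewrite uE.
rewrite fin_numB => /andP[pfin nfin].
rewrite -[fun x => _]/(abse \o (EFin \o u)) fune_abse ge0_integralD//; first last.
- exact: measurable_funeneg.
- exact: measurable_funepos.
by rewrite lte_add_pinfty// ltey_eq ?pfin ?nfin.
Qed.

Lemma has_mean_cst a : has_mean (cst a) a.
Proof.
split; first exact: finite_measure_integrable_cst.
by rewrite -[LHS]/(\int[Q]_s cst a%:E s)%E integral_cst//= probability_setT mule1.
Qed.

Lemma has_meanD u v a b : has_mean u a -> has_mean v b ->
  has_mean (fun s => u s + v s) (a + b).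
Proof.
move=> [iu ua] [iv vb]; split; first exact: (integrableD _ iu iv).
by rewrite EFinD -ua -vb -integralD//.
Qed.

Lemma has_meanZ u a b : has_mean u a -> has_mean (fun s => b * u s) (b * a).
Proof.
move=> [iu ua]; split; first exact: (integrableZl _ _ iu).
by rewrite EFinM -ua -integralZl//.
Qed.

Lemma has_mean_sum n (u : 'I_n -> S -> R) (a : 'I_n -> R) :
  (forall i, has_mean (u i) (a i)) -> has_mean (fun s => \sum_i u i s) (\sum_i a i).
Proof.
move=> ua; elim: (index_enum _) => [|i r ih].
  have := has_mean_cst 0; rewrite big_nil; congr has_mean.
  by apply/funext => s; rewrite big_nil.
have := has_meanD (ua i) ih; rewrite big_cons; congr has_mean.
by apply/funext => s; rewrite big_cons.
Qed.

Lemma has_mean_dot n (G : S -> 'rV[R]_n) (m w : 'rV[R]_n) :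
  (forall i, has_mean (fun s => G s ord0 i) (m ord0 i)) ->
  has_mean (fun s => dot w (G s - m)) 0.
Proof.
move=> Gm; rewrite -[X in has_mean _ X](@big1 _ _ (+%R) _ (index_enum 'I_n) xpredT (fun=> 0))//.
apply: has_mean_sum => i; rewrite -(mulr0 (w ord0 i)); apply: has_meanZ.
rewrite -(subrr (m ord0 i)).
have := has_meanD (Gm i) (has_mean_cst (- m ord0 i)); congr has_mean.
by apply/funext => s; rewrite !mxE.
Qed.

Lemma measurable_enorm_sqr n (G : S -> 'rV[R]_n) : measurable_fun setT G ->
  measurable_fun setT (fun s => enorm (G s) ^+ 2).
Proof.
move=> mG; under eq_fun do rewrite enorm_sqr.
apply: measurable_sum => i.
have mGi : measurable_fun setT (fun s => G s ord0 i).
  exact: (measurableT_comp (@measurable_coord _ _ _ i) mG).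
exact: measurable_funM.
Qed.

(** The linear noise term has mean 0 and the quadratic one is bounded by the variance. Nonnegativity
    of [h] permits the comparison without assuming [h] integrable. *)
Lemma integral_quadratic_le n (G : S -> 'rV[R]_n) (m : 'rV[R]_n) sigma
    (h : S -> R) (c0 c2 : R) (c1 : 'rV[R]_n) :
  measurable_fun setT G -> unbiased_bounded_variance Q G m sigma ->
  measurable_fun setT h -> (forall s, 0 <= h s) -> 0 <= c2 ->
  (forall s, h s <= c0 + dot c1 (G s - m) + c2 * enorm (G s - m) ^+ 2) ->
  (\int[Q]_s (h s)%:E <= (c0 + c2 * sigma ^+ 2)%:E)%E.
Proof.
move=> mG [EG VG] mh h0 c20 hle.
have mGi i : measurable_fun setT (fun s => G s ord0 i).
  exact: (measurableT_comp (@measurable_coord _ _ _ i) mG).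
have Gm i : has_mean (fun s => G s ord0 i) (m ord0 i).
  by apply: has_mean_measurable => //; have := EG i; rewrite unlock.
have mGm : measurable_fun setT (fun s => G s - m).
  apply: measurable_fun_row => i; under eq_fun do rewrite !mxE.
  exact: measurable_funB.
have mE := measurable_enorm_sqr mGm.
pose V := fine (\int[Q]_s (enorm (G s - m) ^+ 2)%:E)%E.
have VGi : (\int[Q]_s (enorm (G s - m) ^+ 2)%:E <= (sigma ^+ 2)%:E)%E.
  by move: VG; rewrite unlock.
have V0 : (0 <= \int[Q]_s (enorm (G s - m) ^+ 2)%:E)%E.
  by apply: integral_ge0 => s _; rewrite lee_fin sqr_ge0.
have VE : (\int[Q]_s (enorm (G s - m) ^+ 2)%:E = V%:E)%E.
  by rewrite fineK// ge0_fin_numE// (le_lt_trans VGi)// ltry.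
have hV : has_mean (fun s => enorm (G s - m) ^+ 2) V by exact: has_mean_measurable.
have [iU UE] := has_meanD (has_meanD (has_mean_cst c0) (has_mean_dot c1 Gm)) (has_meanZ c2 hV).
apply: (@le_trans _ _ (c0 + 0 + c2 * V)%:E).
  rewrite -UE; apply: ge0_le_integral => //.
  - by move=> s _; rewrite lee_fin.
  - exact/measurable_EFinP.
  - by case/integrableP : iU.
  - by move=> s _; rewrite lee_fin.
rewrite lee_fin addr0 lerD2l ler_wpM2l// -lee_fin -VE//.
Qed.

End mean.

(** * Ascent and descent half-steps *)

Section one_step.
Context {R : realType} {d1 d2 : nat}.
Variables (f : 'rV[R]_d1 -> 'rV[R]_d2 -> R) (l mu1 mu2 : R).
Hypotheses (l0 : 0 < l) (mu10 : 0 < mu1) (mu20 : 0 < mu2).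
Hypotheses (mu1l : mu1 <= l) (mu2l : mu2 <= l).
Hypothesis f_diff : forall z : 'rV[R]_d1 * 'rV[R]_d2,
  differentiable (fun u : 'rV[R]_d1 * 'rV[R]_d2 => f u.1 u.2) z.
Hypothesis f_lip : lipschitz_gradient f l.
Hypothesis f_saddle : saddle_point_assumption f.
Hypothesis f_PL : two_sided_PL f mu1 mu2.

Local Notation L := (l + l ^+ 2 / mu2).

Definition lyapunov (z : 'rV[R]_d1 * 'rV[R]_d2) : R :=
  (max_y f z.1 - minmax f) + 10^-1 * (max_y f z.1 - f z.1 z.2).

(* Bounds the expectation of lyapunov after the ascent step in y only. *)
Definition lyapunov_mid (tau2 sigma : R) (z : 'rV[R]_d1 * 'rV[R]_d2) : R :=
  (max_y f z.1 - minmax f) +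
  10^-1 * ((1 - mu2 * tau2) * (max_y f z.1 - f z.1 z.2) + l / 2 * tau2 ^+ 2 * sigma ^+ 2).

Lemma max_y_sub_ge0 z : 0 <= max_y f z.1 - f z.1 z.2.
Proof. by rewrite subr_ge0 le_max_y. Qed.

Lemma minmax_sub_ge0 x : 0 <= max_y f x - minmax f.
Proof. by rewrite subr_ge0 minmax_le. Qed.

Lemma lyapunov_ge0 z : 0 <= lyapunov z.
Proof. by rewrite addr_ge0 ?minmax_sub_ge0// mulr_ge0 ?max_y_sub_ge0. Qed.

Lemma contraction_factor tau2 : 0 <= tau2 -> l * tau2 <= 1 -> 0 <= 1 - mu2 * tau2 <= 1.
Proof.
move=> t0 lt; have : mu2 * tau2 <= l * tau2 by rewrite ler_wpM2r.
by have : 0 <= mu2 * tau2 by [rewrite mulr_ge0// ltW]; lra.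
Qed.

Lemma lyapunov_mid_ge0 tau2 sigma z : 0 <= tau2 -> l * tau2 <= 1 ->
  0 <= lyapunov_mid tau2 sigma z.
Proof.
move=> t0 lt; have /andP[k0 _] := contraction_factor t0 lt.
rewrite addr_ge0 ?minmax_sub_ge0// mulr_ge0// addr_ge0//.
  by rewrite mulr_ge0// max_y_sub_ge0.
by rewrite mulr_ge0 ?sqr_ge0// mulr_ge0 ?sqr_ge0// divr_ge0// ltW.
Qed.

Lemma measurable_max_y : measurable_fun setT (fun z : 'rV[R]_d1 * 'rV[R]_d2 => max_y f z.1).
Proof.
apply: (measurableT_comp _ measurable_fst); apply: continuous_row_measurable.
exact (max_y_continuous l0 mu20 f_diff f_lip f_saddle f_PL).
Qed.

Lemma measurable_uncurried :
  measurable_fun setT (fun z : 'rV[R]_d1 * 'rV[R]_d2 => f z.1 z.2).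
Proof. by apply: continuous_row2_measurable; exact: continuous_uncurried. Qed.

Lemma measurable_lyapunov : measurable_fun setT lyapunov.
Proof.
apply: measurable_funD; first by apply: measurable_funB => //; exact: measurable_max_y.
apply: measurable_funM => //; apply: measurable_funB; first exact: measurable_max_y.
exact: measurable_uncurried.
Qed.

Lemma measurable_lyapunov_mid tau2 sigma : measurable_fun setT (lyapunov_mid tau2 sigma).
Proof.
apply: measurable_funD; first by apply: measurable_funB => //; exact: measurable_max_y.
apply: measurable_funM => //; apply: measurable_funD => //.
apply: measurable_funM => //; apply: measurable_funB; first exact: measurable_max_y.
exact: measurable_uncurried.
Qed.

Section sampling.
Context dS (S : measurableType dS) (Q : probability S R) (sigma : R).

(** Since [l * tau2 <= 1], the net coefficient of the squared gradient in the gap is at most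
    [- tau2 / 2], which the PL inequality in [y] turns into the factor [1 - mu2 * tau2]. *)
Lemma ascent_step (G : S -> 'rV[R]_d2) x y tau2 :
  0 <= tau2 -> l * tau2 <= 1 -> measurable_fun setT G ->
  unbiased_bounded_variance Q G (grad_y f x y) sigma ->
  (\int[Q]_s (lyapunov (x, y + tau2 *: G s))%:E <= (lyapunov_mid tau2 sigma (x, y))%:E)%E.
Proof.
move=> t0 lt mG EG; set g := grad_y f x y in EG *.
apply: le_trans (integral_quadratic_le mG EG
  (c0 := (max_y f x - minmax f) +
    10^-1 * (max_y f x - f x y - tau2 * enorm g ^+ 2 + l / 2 * tau2 ^+ 2 * enorm g ^+ 2))
  (c1 := (10^-1 * (l * tau2 ^+ 2 - tau2)) *: g) (c2 := 10^-1 * (l / 2 * tau2 ^+ 2)) _ _ _ _) _.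
- apply: (measurableT_comp measurable_lyapunov).
  apply: measurable_fun_pair; first exact: measurable_cst.
  by apply: measurable_axpy => //; exact: measurable_cst.
- by move=> s; exact: lyapunov_ge0.
- by rewrite mulr_ge0// mulr_ge0 ?sqr_ge0// divr_ge0// ltW.
- move=> s; rewrite /lyapunov/=.
  have := smooth_r f_diff f_lip x y (tau2 *: G s); rewrite -/g ler_norml => /andP[+ _].
  rewrite dotZr enormZ exprMn (ger0_norm t0) dotZl.
  have -> : enorm (G s) ^+ 2 = enorm g ^+ 2 + 2 * dot g (G s - g) + enorm (G s - g) ^+ 2.
    by rewrite -enorm_sqrD subrKC.
  have -> : dot g (G s) = enorm g ^+ 2 + dot g (G s - g).
    by rewrite enorm_sqr -dotDr subrKC.
  by lra.
- rewrite lee_fin /lyapunov_mid/=.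
  have [_] := f_PL x y; rewrite -/g.
  have : tau2 * (l * tau2) * enorm g ^+ 2 <= tau2 * enorm g ^+ 2.
    by rewrite ler_wpM2r ?sqr_ge0// ler_piMr.
  move=> h1 /(ler_wpM2l t0) h2; lra.
Qed.

Lemma descent_step (G : S -> 'rV[R]_d1) x y tau1 :
  let tau2 := 18 * l ^+ 2 / mu2 ^+ 2 * tau1 in
  0 <= tau1 -> L * tau1 <= 1 -> l * tau2 <= 1 -> measurable_fun setT G ->
  unbiased_bounded_variance Q G (grad_x f x y) sigma ->
  (\int[Q]_s (lyapunov_mid tau2 sigma (x - tau1 *: G s, y))%:E <=
    ((1 - mu1 * tau1 / 2) * lyapunov (x, y) +
     tau1 ^+ 2 * sigma ^+ 2 / 20 * ((L + l) + 18 ^+ 2 * l ^+ 5 / mu2 ^+ 4 + 10 * L))%:E)%E.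
Proof.
move=> tau2 t0 Lt lt mG EG; set p := grad_x f x y in EG *.
pose v := grad_max_y f_saddle x.
have t20 : 0 <= tau2 by rewrite mulr_ge0// divr_ge0 ?sqr_ge0// mulr_ge0 ?sqr_ge0.
have /andP[k0 k1] := contraction_factor t20 lt.
set k := 1 - mu2 * tau2 in k0 k1.
have q0 : 0 <= l ^+ 2 / mu2 by rewrite divr_ge0 ?sqr_ge0 ?(ltW mu20).
(* In [lyapunov_mid], [max_y f] has weight [1 + k / 10] and is bounded above by its smoothness; [f]
   has weight [- k / 10] and is bounded below by its own. The coefficients come from writing
   [G s = p + (G s - p)]. *)
apply: le_trans (integral_quadratic_le mG EG
  (c0 := (1 + k / 10) * (max_y f x - tau1 * dot v p + L / 2 * tau1 ^+ 2 * enorm p ^+ 2)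
    - minmax f - k / 10 * (f x y - tau1 * enorm p ^+ 2 - l / 2 * tau1 ^+ 2 * enorm p ^+ 2)
    + 10^-1 * (l / 2 * tau2 ^+ 2 * sigma ^+ 2))
  (c1 := (1 + k / 10) *: (- tau1 *: v + (L * tau1 ^+ 2) *: p) +
    (k / 10 * (tau1 + l * tau1 ^+ 2)) *: p)
  (c2 := (1 + k / 10) * (L / 2 * tau1 ^+ 2) + k / 10 * (l / 2 * tau1 ^+ 2)) _ _ _ _) _.
- apply: (measurableT_comp (measurable_lyapunov_mid _ _)).
  apply: measurable_fun_pair; last exact: measurable_cst.
  under eq_fun do rewrite -scaleNr.
  by apply: measurable_axpy => //; exact: measurable_cst.
- by move=> s; exact: lyapunov_mid_ge0.
- have L0 : 0 <= L by rewrite addr_ge0// ltW.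
  have l20 : 0 <= l / 2 * tau1 ^+ 2 by rewrite mulr_ge0 ?sqr_ge0// divr_ge0// ltW.
  have L20 : 0 <= L / 2 * tau1 ^+ 2 by rewrite mulr_ge0 ?sqr_ge0// divr_ge0.
  have k10 : 0 <= k / 10 by rewrite divr_ge0.
  by apply: addr_ge0; apply: mulr_ge0 => //; exact: addr_ge0.
- move=> s; rewrite /lyapunov_mid/= -/k.
  have := smooth_l f_diff f_lip x y (- (tau1 *: G s)); rewrite -/p ler_norml => /andP[+ _].
  have := max_y_smooth l0 mu20 f_diff f_lip f_saddle f_PL x (x - tau1 *: G s).
  rewrite (addrAC x) subrr add0r -/v !dotNr !dotZr !enormN !enormZ !exprMn !(ger0_norm t0).
  have -> : enorm (G s) ^+ 2 = enorm p ^+ 2 + 2 * dot p (G s - p) + enorm (G s - p) ^+ 2.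
    by rewrite -enorm_sqrD subrKC.
  have -> : dot p (G s) = enorm p ^+ 2 + dot p (G s - p).
    by rewrite enorm_sqr -dotDr subrKC.
  have -> : dot v (G s) = dot v p + dot v (G s - p).
    by rewrite -dotDr subrKC.
  rewrite dotDl !dotZl dotDl !dotZl.
  set A := max_y f _; set B := f _ y => h1 h2.
  have k10 : 0 <= 1 + k / 10 by lra.
  have k20 : 0 <= k / 10 by lra.
  move: h2; rewrite lerBrDr -subr_ge0 => /(mulr_ge0 k20) h2.
  have := ler_wpM2l k10 h1.
  lra.
rewrite lee_fin /lyapunov/=.
have hv := grad_max_y_PL l0 mu20 f_diff f_lip f_saddle f_PL x mu10.
have he := grad_max_y_gap l0 mu20 f_diff f_lip f_saddle f_PL x y.
rewrite -/v -/p in hv he.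
have eE : enorm (p - v) ^+ 2 = enorm p ^+ 2 - 2 * dot v p + enorm v ^+ 2.
  by rewrite enorm_sqrD dotNr enormN (dotC p); ring.
have pv : enorm p ^+ 2 <= 2 * enorm v ^+ 2 + 2 * enorm (p - v) ^+ 2.
  have := sqr_ge0 (enorm (v - (p - v))); rewrite (enorm_sqrD v (- (p - v))) enormN dotNr.
  have : enorm p ^+ 2 = enorm (v + (p - v)) ^+ 2 by rewrite subrKC.
  by rewrite (enorm_sqrD v (p - v)); lra.
have A0 := minmax_sub_ge0 x.
have B0 := max_y_sub_ge0 (x, y); rewrite /= in B0.
have p0 := sqr_ge0 (enorm p); have v0 := sqr_ge0 (enorm v); have e0 := sqr_ge0 (enorm (p - v)).
move: (enorm p ^+ 2) (enorm v ^+ 2) (enorm (p - v) ^+ 2) (dot v p) => p2 v2 e2 vp in eE pv hv he p0 v0 e0 *.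
have s0 := sqr_ge0 sigma.
move: (sigma ^+ 2) s0 => s2 s0.
set A := max_y f x - minmax f in A0 hv *.
set B := max_y f x - f x y in B0 he *.
(* A common scale: [mu2 * tau2 = 18 * u], and [mu1 * tau1 <= u] because [mu1] and [mu2] are at most
   [l]. *)
pose u := l ^+ 2 / mu2 * tau1.
have kE : k = 1 - 18 * u by rewrite /k /tau2 /u; field; rewrite gt_eqF.
have u0 : 0 <= u by rewrite mulr_ge0.
have lt1 : l * tau1 <= 1.
  by apply: le_trans Lt; rewrite ler_wpM2r// lerDl.
have ltu : mu1 * tau1 <= u.
  rewrite /u ler_wpM2r// (le_trans mu1l)// ler_pdivlMr// expr2 ler_pM2l//.
have eB : tau1 * e2 <= 2 * u * B.
  rewrite /u -(ler_pM2l mu20) [leRHS](_ : _ = tau1 * (2 * l ^+ 2 * B)).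
    by rewrite mulrCA ler_wpM2l.
  by field; rewrite gt_eqF.
have vA : mu1 * tau1 * A <= tau1 * v2 / 2.
  have := ler_wpM2l t0 hv; lra.
(* Polarisation, after [L * tau1 <= 1] has reduced the quadratic term to [tau1 * p2 / 2]. *)
have S1 : - tau1 * vp + L / 2 * tau1 ^+ 2 * p2 <= tau1 / 2 * (e2 - v2).
  have : L * tau1 * (tau1 * p2) <= tau1 * p2.
    by rewrite ler_piMl// mulr_ge0.
  have -> : vp = (p2 + v2 - e2) / 2 by rewrite eE; field.
  lra.
have S2 : tau1 * p2 + l / 2 * tau1 ^+ 2 * p2 <= 3 * (tau1 * v2 + tau1 * e2).
  have : l * tau1 * (tau1 * p2) <= tau1 * p2 by rewrite ler_piMl// mulr_ge0.
  have := ler_wpM2l t0 pv; lra.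
have tv : 0 <= tau1 * v2 by rewrite mulr_ge0.
have te : 0 <= tau1 * e2 by rewrite mulr_ge0.
(* The coefficient of [tau1 * v2] is [- 1 / 2 + 5 / 2 * (k / 10)], at most [- 1 / 4] as [k <= 1]; by
   [vA] this pays for [mu1 * tau1 / 2 * A]. The [e2] terms become gap terms by [eB]. *)
have S3 : (1 + k / 10) * (max_y f x - tau1 * vp + L / 2 * tau1 ^+ 2 * p2) - minmax f
    - k / 10 * (f x y - tau1 * p2 - l / 2 * tau1 ^+ 2 * p2)
  <= A + k / 10 * B - mu1 * tau1 / 2 * A + (1 / 2 + 7 / 2 * (k / 10)) * (2 * u * B).
  have k10 : 0 <= 1 + k / 10 by lra.
  have k20 : 0 <= k / 10 by lra.
  have := ler_wpM2l k10 S1; have := ler_wpM2l k20 S2.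
  have k30 : 0 <= 1 / 2 + 7 / 2 * (k / 10) by lra.
  have := ler_wpM2l k30 eB.
  have : k / 10 * (tau1 * v2) <= 1 / 10 * (tau1 * v2) by rewrite ler_wpM2r//; lra.
  by move: vA; rewrite /A /B; lra.
(* The factor 18 is large enough: the contraction gains [18 / 10 * u] and the errors cost at most
   [17 / 10 * u], leaving [u / 10] to cover [mu1 * tau1 / 20]. *)
have S4 : k / 10 * B + (1 / 2 + 7 / 2 * (k / 10)) * (2 * u * B) <= (1 - mu1 * tau1 / 2) * (10^-1 * B).
  rewrite -subr_ge0 kE.
  have -> : (1 - mu1 * tau1 / 2) * (10^-1 * B) -
      ((1 - 18 * u) / 10 * B + (1 / 2 + 7 / 2 * ((1 - 18 * u) / 10)) * (2 * u * B))
    = (u / 10 + 126 / 10 * (u * u) - mu1 * tau1 / 20) * B by field.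
  rewrite mulr_ge0//; have : 0 <= u * u by rewrite mulr_ge0.
  lra.
have S5 : ((1 + k / 10) * (L / 2 * tau1 ^+ 2) + k / 10 * (l / 2 * tau1 ^+ 2)) * s2
   <= tau1 ^+ 2 * s2 / 20 * ((L + l) + 10 * L).
  have Ll0 : 0 <= (L + l) * tau1 ^+ 2 * s2 by rewrite !mulr_ge0 ?sqr_ge0// !addr_ge0 ?(ltW l0).
  have : k * ((L + l) * tau1 ^+ 2 * s2) <= (L + l) * tau1 ^+ 2 * s2 by rewrite ler_piMl.
  lra.
have S6 : 10^-1 * (l / 2 * tau2 ^+ 2 * s2) = tau1 ^+ 2 * s2 / 20 * (18 ^+ 2 * l ^+ 5 / mu2 ^+ 4).
  by rewrite /tau2; field; rewrite gt_eqF.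
rewrite S6; lra.
Qed.

End sampling.
End one_step.

(** * The iterates *)

Section stochastic_agda.
Context {R : realType} {d1 d2 : nat} dS (S : measurableType dS).
Variables (Gx : 'rV[R]_d1 -> 'rV[R]_d2 -> S -> 'rV[R]_d1)
  (Gy : 'rV[R]_d1 -> 'rV[R]_d2 -> S -> 'rV[R]_d2).
Local Notation Z := ('rV[R]_d1 * 'rV[R]_d2)%type.
Hypothesis mGx : measurable_fun setT (fun z : Z * S => Gx z.1.1 z.1.2 z.2).
Hypothesis mGy : measurable_fun setT (fun z : Z * S => Gy z.1.1 z.1.2 z.2).

(** An iteration is split into half-steps, each consuming one sample, so that the step in [y] can be
    averaged with the updated [x] held fixed. *)
Definition descend (t : R) (z : Z * S) : Z := (z.1.1 - t *: Gx z.1.1 z.1.2 z.2, z.1.2).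
Definition ascend (t : R) (z : Z * S) : Z := (z.1.1, z.1.2 + t *: Gy z.1.1 z.1.2 z.2).

Lemma stoc_agdaS tau1 tau2 x0 y0 s1 s2 t :
  stoc_agda Gx Gy tau1 tau2 x0 y0 s1 s2 t.+1 =
  ascend (tau2 t) (descend (tau1 t) (stoc_agda Gx Gy tau1 tau2 x0 y0 s1 s2 t, s1 t), s2 t).
Proof. by rewrite /=; case: (stoc_agda _ _ _ _ _ _ _ _ t). Qed.

Let m11 : measurable_fun setT (fun z : Z * S => z.1.1).
Proof. by apply: (measurableT_comp measurable_fst); exact: measurable_fst. Qed.

Let m12 : measurable_fun setT (fun z : Z * S => z.1.2).
Proof. by apply: (measurableT_comp measurable_snd); exact: measurable_fst. Qed.

Lemma measurable_descend t : measurable_fun setT (descend t).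
Proof.
apply: measurable_fun_pair => //; under eq_fun do rewrite -scaleNr.
exact: measurable_axpy.
Qed.

Lemma measurable_ascend t : measurable_fun setT (ascend t).
Proof. by apply: measurable_fun_pair => //; exact: measurable_axpy. Qed.

Section iterates.
Context dO (Omega : measurableType dO) (P : probability Omega R)
  (xi1 xi2 : nat -> {RV P >-> S}).
Variables (tau1 tau2 : nat -> R) (x0 : 'rV[R]_d1) (y0 : 'rV[R]_d2).

Let xi (k : nat + nat) : {RV P >-> S} :=
  match k with inl t => xi1 t | inr t => xi2 t end.

Hypothesis xi_indep : mutually_independent xi.

Let z t w := stoc_agda Gx Gy tau1 tau2 x0 y0 (xi1 ^~ w) (xi2 ^~ w) t.

Definition iterate_mid t w := descend (tau1 t) (z t w, xi1 t w).

(* The samples not yet drawn after n half-steps: xi1 t is drawn at half-step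
   2 t and xi2 t at half-step 2 t + 1. *)
Definition unused (n : nat) : pred (nat + nat) := fun k =>
  (n <= match k with inl t => t.*2 | inr t => t.*2.+1 end)%N.

Lemma descend_independent t :
  measurable_fun setT (z t) -> independent_of_family xi (z t) (unused t.*2) ->
  measurable_fun setT (iterate_mid t) /\
  independent_of_family xi (iterate_mid t) (unused t.*2.+1).
Proof.
move=> mz iz; split.
  apply: (measurableT_comp (measurable_descend _)).
  exact: measurable_fun_pair.
apply: (independent_step (k := inl t) mz _ iz (measurable_descend _)).
- by rewrite /unused.
- by move=> k; exact: ltnW.
- by rewrite /unused -ltnNge.
Qed.

(** Induction over pairs of half-steps: each one absorbs a single sample and keeps independence from
    all later ones. *)
Lemma iterate_independent t :
  measurable_fun setT (z t) /\ independent_of_family xi (z t) (unused t.*2).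
Proof.
elim: t => [|t [mz iz]].
  by split; [exact: measurable_cst|exact: independent_cst].
have [mmid imid] := descend_independent mz iz.
rewrite (_ : z t.+1 = fun w => ascend (tau2 t) (iterate_mid t w, xi2 t w)); last first.
  by apply/funext => w; rewrite /z stoc_agdaS.
split.
  apply: (measurableT_comp (measurable_ascend _)).
  exact: measurable_fun_pair.
rewrite doubleS.
apply: (independent_step (k := inr t) mmid _ imid (measurable_ascend _)).
- by rewrite /unused.
- by move=> k; exact: ltnW.
- by rewrite /unused -ltnNge.
Qed.

Lemma iterate_mid_independent t :
  measurable_fun setT (iterate_mid t) /\
  independent_of_family xi (iterate_mid t) (unused t.*2.+1).
Proof. by have [mz iz] := iterate_independent t; exact: descend_independent. Qed.

Variable Q : probability S R.
Hypothesis xi1Q : forall t A, measurable A -> distribution P (xi1 t) A = Q A.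
Hypothesis xi2Q : forall t A, measurable A -> distribution P (xi2 t) A = Q A.

Lemma integral_descend_le (F h : Z -> R) t : measurable_fun setT F ->
  (forall u, 0 <= F u) -> measurable_fun setT h ->
  (forall u, \int[Q]_s (F (descend (tau1 t) (u, s)))%:E <= (h u)%:E)%E ->
  (\int[P]_w (F (iterate_mid t w))%:E <= \int[P]_w (h (z t w))%:E)%E.
Proof.
move=> mF F0; have [mz iz] := iterate_independent t.
apply: (@integral_independent_le _ _ _ _ _ _ _ xi _ _ (z t) (unused t.*2) (inl t) mz _ iz Q
  (fun u => (F (descend (tau1 t) u))%:E)).
- by rewrite /unused.
- exact: xi1Q.
- by apply/measurable_EFinP; apply: (measurableT_comp mF); exact: measurable_descend.
- by move=> u; rewrite lee_fin.
Qed.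

Lemma integral_ascend_le (F h : Z -> R) t : measurable_fun setT F ->
  (forall u, 0 <= F u) -> measurable_fun setT h ->
  (forall u, \int[Q]_s (F (ascend (tau2 t) (u, s)))%:E <= (h u)%:E)%E ->
  (\int[P]_w (F (z t.+1 w))%:E <= \int[P]_w (h (iterate_mid t w))%:E)%E.
Proof.
move=> mF F0; have [mz iz] := iterate_mid_independent t.
under eq_integral do rewrite /z stoc_agdaS.
apply: (@integral_independent_le _ _ _ _ _ _ _ xi _ _ (iterate_mid t) (unused t.*2.+1) (inr t) mz _ iz Q
  (fun u => (F (ascend (tau2 t) u))%:E)).
- by rewrite /unused.
- exact: xi2Q.
- by apply/measurable_EFinP; apply: (measurableT_comp mF); exact: measurable_ascend.
- by move=> u; rewrite lee_fin.
Qed.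

End iterates.

End stochastic_agda.

(* (s - 1) / s^2 <= 1 / (s + 1) is what makes the rate 1 / (gamma + t) inductive. *)
Lemma rate_step (R : realFieldType) (s m nu N : R) : 0 < s -> 2 < m -> 0 <= nu ->
  N / (10 * m - 20) <= nu ->
  (1 - m / s / 2) * (nu / s) + N / s ^+ 2 / 20 <= nu / (s + 1).
Proof.
move=> s0 m2 nu0 hN.
have m20 : 0 < 10 * m - 20 by lra.
have s10 : 0 < s + 1 by lra.
move: hN; rewrite ler_pdivrMr// => hN.
rewrite ler_pdivlMr//.
have -> : ((1 - m / s / 2) * (nu / s) + N / s ^+ 2 / 20) * (s + 1) =
  (((s - m / 2) * nu + N / 20) * (s + 1)) / s ^+ 2 by field; rewrite gt_eqF.
rewrite ler_pdivrMr ?exprn_gt0//.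
(* [hN] bounds [N / 20] by [(m / 2 - 1) * nu], so the [m / 2] terms cancel. *)
have h : (s - m / 2) * nu + N / 20 <= (s - 1) * nu by lra.
have := ler_wpM2r (ltW s10) h; lra.
Qed.

(** * Recursion for the potential and the resulting rate *)

Theorem theorem3p3 (R : realType) (d1 d2 : nat)
    (f : 'rV[R]_d1 -> 'rV[R]_d2 -> R) (l mu1 mu2 : R)
    (dS : measure_display) (S : measurableType dS) (Q : probability S R)
    (Gx : 'rV[R]_d1 -> 'rV[R]_d2 -> S -> 'rV[R]_d1)
    (Gy : 'rV[R]_d1 -> 'rV[R]_d2 -> S -> 'rV[R]_d2) (sigma : R)
    (dO : measure_display) (Omega : measurableType dO)
    (P : probability Omega R) (xi1 xi2 : nat -> {RV P >-> S})
    (x0 : 'rV[R]_d1) (y0 : 'rV[R]_d2) (beta gamma : R) :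
  0 < l -> 0 < mu1 -> 0 < mu2 -> mu1 <= l -> mu2 <= l ->
  continuously_differentiable f ->
  lipschitz_gradient f l ->
  saddle_point_assumption f ->
  two_sided_PL f mu1 mu2 ->
  stochastic_gradients f Q Gx Gy sigma ->
  iid_samples Q xi1 xi2 ->
  2 / mu1 < beta -> 0 < gamma ->
  let L := l + l ^+ 2 / mu2 in
  let tau1 t := beta / (gamma + t%:R) in
  let tau2 t := 18 * l ^+ 2 * beta / (mu2 ^+ 2 * (gamma + t%:R)) in
  tau1 0%N <= Num.min (1 / L) (mu2 ^+ 2 / (18 * l ^+ 3)) ->
  let z t w := stoc_agda Gx Gy tau1 tau2 x0 y0 (xi1 ^~ w) (xi2 ^~ w) t in
  let Pt t := potential P f (z t) in
  let nu := maxe (gamma%:E * Pt 0%N)%E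
    (((L + l) * beta ^+ 2 + 18 ^+ 2 * l ^+ 5 * beta ^+ 2 / mu2 ^+ 4
        + 10 * L * beta ^+ 2) * sigma ^+ 2 / (10 * mu1 * beta - 20))%:E in
  forall t : nat, (Pt t <= nu * ((gamma + t%:R)^-1)%:E)%E.
Proof.
move=> l0 mu10 mu20 mu1l mu2l [f_diff _ _] f_lip f_saddle f_PL.
move=> [mGx mGy EGx EGy] [xi1Q xi2Q xi_indep] hbeta gamma0 L tau1 tau2 htau z Pt nu.
have beta0 : 0 < beta by apply: lt_trans hbeta; rewrite divr_gt0.
have m2 : 2 < mu1 * beta by move: hbeta; rewrite ltr_pdivrMr// mulrC.
have st t : 0 < gamma + t%:R by rewrite ltr_wpDr.
have q0 : 0 <= l ^+ 2 / mu2 by rewrite divr_ge0 ?sqr_ge0 ?(ltW mu20).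
have L0 : 0 < L by rewrite ltr_wpDr.
have tau10 t : 0 <= tau1 t by rewrite divr_ge0 ?(ltW beta0) ?(ltW (st t)).
have tau1_le t : tau1 t <= tau1 0%N.
  rewrite /tau1 addr0 ler_pM2l// lef_pV2 ?posrE//.
  by rewrite lerDl.
have Ltau t : L * tau1 t <= 1.
  have := le_trans (tau1_le t) htau; rewrite le_min => /andP[+ _].
  by rewrite ler_pdivlMr// mulrC.
have tau2E t : tau2 t = 18 * l ^+ 2 / mu2 ^+ 2 * tau1 t.
  by rewrite /tau2 /tau1; field; rewrite !gt_eqF.
have ltau t : l * tau2 t <= 1.
  have := le_trans (tau1_le t) htau; rewrite le_min => /andP[_].
  have l30 : 0 < 18 * l ^+ 3 by rewrite mulr_gt0 ?exprn_gt0.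
  rewrite ler_pdivlMr// => h.
  rewrite tau2E; have -> : l * (18 * l ^+ 2 / mu2 ^+ 2 * tau1 t) = tau1 t * (18 * l ^+ 3) / mu2 ^+ 2.
    by field; rewrite gt_eqF.
  by rewrite ler_pdivrMr ?mul1r// exprn_gt0.
have mG1 x y : measurable_fun setT (Gx x y).
  have mp : measurable_fun setT (fun s : S => ((x, y), s)) by exact: measurable_fun_pair.
  exact: (measurableT_comp mGx mp).
have mG2 x y : measurable_fun setT (Gy x y).
  have mp : measurable_fun setT (fun s : S => ((x, y), s)) by exact: measurable_fun_pair.
  exact: (measurableT_comp mGy mp).
have mz t : measurable_fun setT (z t).
  by have [] := iterate_independent mGx mGy tau1 tau2 x0 y0 xi_indep t.
pose V := lyapunov f.
have V0 := lyapunov_ge0 f_saddle.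
have mV := measurable_lyapunov l0 mu20 f_diff f_lip f_saddle f_PL.
(* Both expectations merge by additivity for nonnegative functions; neither is known to be finite at
   this point. *)
have PtE t : Pt t = (\int[P]_w (V (z t w))%:E)%E.
  rewrite /Pt /potential unlock -ge0_integralZl//; first last.
  - by move=> w _; rewrite lee_fin max_y_sub_ge0.
  - apply/measurable_EFinP; apply: (@measurableT_comp _ _ _ _ _ _ (fun u => max_y f u.1 - f u.1 u.2)) => //.
    apply: measurable_funB; last exact: measurable_uncurried.
    exact: (measurable_max_y l0 mu20 f_diff f_lip f_saddle f_PL).
  rewrite -ge0_integralD//.
  - by move=> w _; rewrite lee_fin minmax_sub_ge0.
  - apply/measurable_EFinP; apply: measurable_funB => //.
    apply: (@measurableT_comp _ _ _ _ _ _ (fun u => max_y f u.1)) => //.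
    exact: (measurable_max_y l0 mu20 f_diff f_lip f_saddle f_PL).
  - by move=> w _; rewrite mule_ge0// lee_fin max_y_sub_ge0.
  - apply: measurable_funeM.
    apply/measurable_EFinP; apply: (@measurableT_comp _ _ _ _ _ _ (fun u => max_y f u.1 - f u.1 u.2)) => //.
    apply: measurable_funB; last exact: measurable_uncurried.
    exact: (measurable_max_y l0 mu20 f_diff f_lip f_saddle f_PL).
pose C t := tau1 t ^+ 2 * sigma ^+ 2 / 20 * ((L + l) + 18 ^+ 2 * l ^+ 5 / mu2 ^+ 4 + 10 * L).
have C0 t : 0 <= C t.
  have C10 : 0 <= tau1 t ^+ 2 * sigma ^+ 2 / 20 by rewrite divr_ge0// mulr_ge0 ?sqr_ge0.
  have C20 : 0 <= 18 ^+ 2 * l ^+ 5 / mu2 ^+ 4.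
    by rewrite divr_ge0 ?exprn_ge0 ?(ltW mu20)// mulr_ge0 ?exprn_ge0 ?(ltW l0).
  rewrite /C mulr_ge0//; lra.
have rho0 t : 0 <= 1 - mu1 * tau1 t / 2.
  have : mu1 * tau1 t <= L * tau1 t.
    by rewrite ler_wpM2r// (le_trans mu1l)// lerDl.
  have := Ltau t; lra.
(* First [xi2 t] is integrated out, which leaves [lyapunov_mid] at the new [x] and old [y]; then
   [xi1 t]. *)
have step t : (Pt t.+1 <= (1 - mu1 * tau1 t / 2)%:E * Pt t + (C t)%:E)%E.
  rewrite !PtE.
  have tau20 : 0 <= tau2 t by rewrite tau2E mulr_ge0// divr_ge0 ?sqr_ge0// mulr_ge0 ?sqr_ge0.
  have mM := measurable_lyapunov_mid l0 mu20 f_diff f_lip f_saddle f_PL (tau2 t) sigma.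
  apply: (@le_trans _ _ (\int[P]_w (lyapunov_mid f l mu2 (tau2 t) sigma
      (iterate_mid Gx Gy xi1 xi2 tau1 tau2 x0 y0 t w))%:E)%E).
    apply: (@integral_ascend_le _ _ _ _ _ _ _ mGx mGy _ _ _ xi1 xi2 tau1 tau2 x0 y0 xi_indep Q xi2Q V
      (lyapunov_mid f l mu2 (tau2 t) sigma) t) => // -[x y].
    exact (ascent_step l0 mu20 f_diff f_lip f_saddle f_PL tau20 (ltau t) (mG2 x y) (EGy x y)).
  apply: (@le_trans _ _ (\int[P]_w ((1 - mu1 * tau1 t / 2) * V (z t w) + C t)%:E)%E).
    apply: (@integral_descend_le _ _ _ _ _ _ _ mGx mGy _ _ _ xi1 xi2 tau1 tau2 x0 y0 xi_indep Q xi1Q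
      (lyapunov_mid f l mu2 (tau2 t) sigma) (fun u => (1 - mu1 * tau1 t / 2) * V u + C t) t) => //.
    - by move=> u; apply: (lyapunov_mid_ge0 l0 mu20 mu2l f_saddle).
    - by apply: measurable_funD => //; apply: measurable_funM.
    - move=> [x y]; rewrite tau2E.
      have ltau' := ltau t; rewrite tau2E in ltau'.
      exact (descent_step l0 mu10 mu20 mu1l mu2l f_diff f_lip f_saddle f_PL
        (tau10 t) (Ltau t) ltau' (mG1 x y) (EGx x y)).
  under eq_integral do rewrite EFinD EFinM.
  have mVz : measurable_fun setT (fun w => (V (z t w))%:E).
    by apply/measurable_EFinP; exact: (measurableT_comp mV (mz t)).
  rewrite ge0_integralD//.
  - rewrite ge0_integralZl ?lee_fin//; last by move=> w _; rewrite lee_fin.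
    by rewrite integral_cst//= probability_setT mule1.
  - by move=> w _; rewrite mule_ge0// lee_fin.
  - exact: measurable_funeM.
  - by move=> w _; rewrite lee_fin.
(* The starting point is deterministic, so [nu] is a real number and the induction can be run with
   real bounds. *)
have P0E : Pt 0%N = (V (x0, y0))%:E.
  rewrite PtE /z/=; under eq_integral do rewrite -[X in (V X)]/(x0, y0).
  by rewrite integral_cst//= probability_setT mule1.
pose N := ((L + l) * beta ^+ 2 + 18 ^+ 2 * l ^+ 5 * beta ^+ 2 / mu2 ^+ 4 + 10 * L * beta ^+ 2) * sigma ^+ 2.
pose nur := Num.max (gamma * V (x0, y0)) (N / (10 * mu1 * beta - 20)).
have nuE : nu = nur%:E by rewrite /nu P0E -EFinM -EFin_max.
have nur0 : 0 <= nur by rewrite le_max mulr_ge0// ltW.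
rewrite nuE; elim => [|t IH].
  rewrite P0E addr0 -EFinM lee_fin ler_pdivlMr// mulrC.
  by rewrite le_max lexx.
apply: (le_trans (step t)).
have : ((1 - mu1 * tau1 t / 2)%:E * Pt t + (C t)%:E <=
    (1 - mu1 * tau1 t / 2)%:E * (nur%:E * (gamma + t%:R)^-1%:E) + (C t)%:E)%E.
  by rewrite leeD2r// lee_wpmul2l// lee_fin.
move=> /le_trans; apply.
rewrite -!EFinM -EFinD lee_fin -[t.+1%:R]natr1 addrA.
have hN : N / (10 * (mu1 * beta) - 20) <= nur by rewrite mulrA le_max lexx orbT.
have := rate_step (st t) m2 nur0 hN.
rewrite (_ : mu1 * beta / (gamma + t%:R) = mu1 * tau1 t); last by rewrite /tau1 mulrA.
rewrite (_ : N / (gamma + t%:R) ^+ 2 / 20 = C t)//.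
by rewrite /N /C /tau1; field; rewrite !gt_eqF.
Qed.
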